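(* Let $(R,\mathfrak m,k)$ be an equicharacteristic Cohen-Macaulay local ring of dimension $d\ge1$ with infinite residue field, and let $I\subsetneq R$ be an ideal with $\ell(I)=d$. Let $H=(y_1,\dots,y_d)$ be a minimal reduction of $I$, set $H_{d-1}=(y_1,\dots,y_{d-1})$, and assume $$\lambda\Big(I^2/\big[y_dI+I^3+(H_{d-1}:I^\infty)\cap I^2\big]\Big)\le1.$$ If one of the following two conditions holds: (i) $I$ is $\mathfrak m$-primary and $H\cap I^2=HI$; (ii) $\operatorname{depth}(R/I)\ge1$, $I$ satisfies $G_d$ and $AN^-_{d-2}$, and $H_{d-1}:I$ is a geometric $(d-1)$-residual intersection of $I$; then $I$ is $j$-stretched.
   Context: $\lambda$ denotes length. An ideal $J\subseteq I$ is a reduction of $I$ if $I^{n+1}=JI^n$ for some $n\ge0$; it is minimal if minimal under inclusion. $\ell(I)$ is the analytic spread. For an ideal $L$, $L:I^\infty=\{b\in R: bI^\delta\subseteq L\text{ for some }\delta>0\}$. General elements: fix generators $I=(a_1,\dots,a_s)$. An assertion holds for general elements $x_1,\dots,x_t$ of $I$ if there is a Zariski dense open subset $U\subseteq k^{ts}$ such that it holds for all $x_i=\sum_{j}\lambda_{ij}a_j$ with $(\lambda_{ij})\in R^{ts}$ whose image in $k^{ts}$ lies in $U$. For $x_1,\dots,x_d$ general elements of $I$ let $J_{d-1}=(x_1,\dots,x_{d-1})$, $\overline R=R/(J_{d-1}:I^\infty)$, and let a bar denote images in $\overline R$. The ideal $I$ (with $\ell(I)=d$) is $j$-stretched if $\lambda\big(\overline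 I^2/(x_d\overline I+\overline I^3)\big)\le1$ for general $x_1,\dots,x_d$. $I$ satisfies $G_t$ if $I_{\mathfrak p}$ can be generated by $i$ elements for every $\mathfrak p\in V(I)$ with $\dim R_{\mathfrak p}=i<t$. For $H_t=(x_1,\dots,x_t)$ with $x_i\in I$, $H_t:I$ is a $t$-residual intersection of $I$ if $I_{\mathfrak p}=(H_t)_{\mathfrak p}$ for every prime $\mathfrak p$ with $\dim R_{\mathfrak p}\le t-1$; it is a geometric $t$-residual intersection if in addition $I_{\mathfrak p}=(H_t)_{\mathfrak p}$ for every $\mathfrak p\in V(I)$ with $\dim R_{\mathfrak p}\le t$. $I$ satisfies $AN_t^-$ if for every $0\le i\le t$ and every geometric $i$-residual intersection $H_i:I$ of $I$, the ring $R/(H_i:I)$ is Cohen-Macaulay (vacuous if $t<0$). *)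

(* Defs.v *)
From HB Require Import structures.
From mathcomp Require Import all_boot all_algebra.
From mathcomp Require Import boolp classical_sets cardinality.
From mathcomp Require mpoly.
From mathcomp Require Import ring.

Set Implicit Arguments.
Unset Strict Implicit.
Unset Printing Implicit Defensive.

Import GRing.Theory.

Local Open Scope classical_set_scope.
Local Open Scope quotient_scope.
Local Open Scope ring_scope.

(* Commutative rings are [comPzRingType]s, so that quotients by the unit ideal
   are allowed.  Ideals are classical sets; the ideals of ring_quotient.v are
   boolean and proper, hence not closed under colon and saturation. *)

Record ideal (R : comPzRingType) := Ideal {
  ideal_set :> R -> Prop;
  ideal_has0 : ideal_set 0;
  ideal_addP : forall x y, ideal_set x -> ideal_set y -> ideal_set (x + y);
  ideal_mulP : forall a x, ideal_set x -> ideal_set (a * x) }.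

Declare Scope ideal_scope.
Delimit Scope ideal_scope with ideal.
Bind Scope ideal_scope with ideal.

Lemma ideal_eq (R : comPzRingType) (I J : ideal R) :
  I = J <-> (I : set R) = (J : set R).
Proof.
split=> [-> //|]; case: I J => I I0 ID IM [J J0 JD JM] /= eIJ.
case: J / eIJ J0 JD JM => J0 JD JM.
by congr Ideal; exact: Prop_irrelevance.
Qed.

Section IdealOperations.
Variable R : comPzRingType.
Implicit Types (I J L : ideal R) (A : set R) (s : seq R).

Definition ideal_gen A : ideal R.
Proof.
exists [set x | forall J, A `<=` J -> J x].
- by move=> J _; exact: ideal_has0.
- by move=> x y Ax Ay J AJ; apply: ideal_addP; [exact: Ax|exact: Ay].
- by move=> a x Ax J AJ; apply: ideal_mulP; exact: Ax.
Defined.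

Definition ideal_span s : ideal R := ideal_gen [set` s].

Definition ideal_one : ideal R.
Proof. by exists [set: R]. Defined.

Definition ideal_add I J : ideal R := ideal_gen (I `|` J).

Definition ideal_mul I J : ideal R :=
  ideal_gen [set x | exists a b, [/\ I a, J b & x = a * b]].

Definition ideal_exp I n : ideal R := iter n (ideal_mul I) ideal_one.

Definition ideal_cap I J : ideal R.
Proof.
exists (I `&` J).
- by split; exact: ideal_has0.
- by move=> x y [Ix Jx] [Iy Jy]; split; exact: ideal_addP.
- by move=> a x [Ix Jx]; split; exact: ideal_mulP.
Defined.

Definition ideal_colon L I : ideal R.
Proof.
exists [set b | forall x, I x -> L (b * x)].
- by move=> x _ /=; rewrite mul0r; exact: ideal_has0.
- move=> b c Lb Lc x Ix /=; rewrite mulrDl.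
  by apply: ideal_addP; [exact: Lb|exact: Lc].
- by move=> a b Lb x Ix /=; rewrite -mulrA; apply/ideal_mulP/Lb.
Defined.

Lemma ideal_expS_sub I n : ideal_exp I n.+1 `<=` ideal_exp I n.
Proof.
move=> x; apply => _ [a [b [_ Ib ->]]]; exact: ideal_mulP.
Qed.

Lemma ideal_exp_sub I m n : (m <= n)%N -> ideal_exp I n `<=` ideal_exp I m.
Proof.
elim: n => [|n IHn]; first by rewrite leqn0 => /eqP ->.
rewrite leq_eqVlt => /orP[/eqP -> //|]; rewrite ltnS => /IHn nm.
exact: subset_trans (@ideal_expS_sub _ _) nm.
Qed.

Definition ideal_sat L I : ideal R.
Proof.
exists [set b | exists2 e : nat, (0 < e)%N &
                  forall x, ideal_exp I e x -> L (b * x)].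
- by exists 1 => // x _; rewrite mul0r; exact: ideal_has0.
- move=> b c [e e0 Lb] [f f0 Lc]; exists (maxn e f).
    by rewrite (leq_trans e0)// leq_maxl.
  move=> x Ix; rewrite mulrDl; apply: ideal_addP.
    by apply: Lb; apply: ideal_exp_sub Ix; rewrite leq_maxl.
  by apply: Lc; apply: ideal_exp_sub Ix; rewrite leq_maxr.
- move=> a b [e e0 Lb]; exists e => // x Ix.
  by rewrite -mulrA; apply/ideal_mulP/Lb.
Defined.

End IdealOperations.

Notation "I + J" := (ideal_add I J) : ideal_scope.
Notation "I * J" := (ideal_mul I J) : ideal_scope.
Notation "I ^+ n" := (ideal_exp I n) : ideal_scope.
Notation "I :&: J" := (ideal_cap I J) : ideal_scope.

Section IdealPredicates.
Variable R : comPzRingType.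
Implicit Types (I J P : ideal R).

Definition is_proper I := ~ I 1.

Definition is_prime P :=
  is_proper P /\ forall x y, P (x * y) -> P x \/ P y.

Definition is_maximal P :=
  is_proper P /\ forall J, P `<=` J -> is_proper J -> J `<=` P.

Definition is_primary P :=
  is_proper P /\ forall x y, P (x * y) -> P x \/ exists n, P (y ^+ n).

Definition radical I : set R := [set x | exists n, I (x ^+ n)].

Definition noetherian := forall I, exists s : seq R, I = ideal_span s.

End IdealPredicates.
Arguments noetherian R : clear implicits.

Record primeideal (R : comPzRingType) := PrimeIdeal {
  prime_ideal :> ideal R;
  prime_idealP : is_prime prime_ideal }.

Record maxideal (R : comPzRingType) := MaxIdeal {
  max_ideal :> ideal R;
  max_idealP : is_maximal max_ideal }.

Definition local_ring (R : comPzRingType) (m : maxideal R) :=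
  forall n : maxideal R, n = m :> ideal R.

Definition primary_to (R : comPzRingType) (m : maxideal R) (I : ideal R) :=
  is_primary I /\ radical I = m.

(* The extension of an ideal along a ring morphism. *)
Definition ideal_ext (R S : comPzRingType) (f : R -> S) (I : ideal R) :
  ideal S := ideal_gen (f @` I).

Section Quotient.
Variables (R : comPzRingType) (K : ideal R).

Definition ideal_pred : R -> bool := fun x => `[< K x >].

Lemma ideal_predE x : (x \in ideal_pred) = `[< K x >]. Proof. by []. Qed.

Fact ideal_pred_zmod_closed : zmod_closed ideal_pred.
Proof.
split=> [|x y]; rewrite !ideal_predE; first exact/asboolP/ideal_has0.
move=> /asboolP Kx /asboolP Ky; apply/asboolP/ideal_addP => //.
by rewrite -mulN1r; exact: ideal_mulP.
Qed.
HB.instance Definition _ :=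
  GRing.isZmodClosed.Build R ideal_pred ideal_pred_zmod_closed.

Definition quot :=
  @Quotient.quot R (GRing.ZmodClosed.clone R ideal_pred _).
HB.instance Definition _ := GRing.Zmodule.on quot.
HB.instance Definition _ := EqQuotient.on quot.
HB.instance Definition _ := ZmodQuotient.on quot.

Definition quot_proj (x : R) : quot := \pi_quot x.

Lemma quot_projP x y : quot_proj x = quot_proj y <-> K (x - y).
Proof.
rewrite /quot_proj; split=> [/eqP|Kxy]; last apply/eqP.
  by rewrite -[_ == _]Quotient.idealrBE => /asboolP.
by rewrite -[_ == _]Quotient.idealrBE; apply/asboolP.
Qed.

Definition quot_mul (x y : quot) : quot := quot_proj (repr x * repr y).

Lemma quot_repr x : quot_proj (repr x) = x. Proof. exact: reprK. Qed.

Lemma quot_projM x y : quot_proj (x * y) = quot_mul (quot_proj x) (quot_proj y).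
Proof.
have repK z : K (z - repr (quot_proj z)) by apply/quot_projP; rewrite quot_repr.
apply/quot_projP.
have -> : x * y - repr (quot_proj x) * repr (quot_proj y)
  = x * (y - repr (quot_proj y)) + repr (quot_proj y) * (x - repr (quot_proj x)).
  by ring.
by apply: ideal_addP; exact: ideal_mulP.
Qed.

Lemma quot_projD x y : quot_proj (x + y) = quot_proj x + quot_proj y.
Proof. by rewrite /quot_proj !piE. Qed.

Lemma quot_ind (P : quot -> Prop) : (forall x, P (quot_proj x)) -> forall x, P x.
Proof. by move=> h x; rewrite -(quot_repr x). Qed.

Fact quot_mulA : associative quot_mul.
Proof.
by elim/quot_ind=> x; elim/quot_ind=> y; elim/quot_ind=> z; rewrite -!quot_projM mulrA.
Qed.
Fact quot_mulC : commutative quot_mul.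
Proof. by elim/quot_ind=> x; elim/quot_ind=> y; rewrite -!quot_projM mulrC. Qed.
Fact quot_mul1 : left_id (quot_proj 1) quot_mul.
Proof. by elim/quot_ind=> x; rewrite -!quot_projM mul1r. Qed.
Fact quot_mulD : left_distributive quot_mul +%R.
Proof.
elim/quot_ind=> x; elim/quot_ind=> y; elim/quot_ind=> z.
by rewrite -quot_projD -!quot_projM -quot_projD mulrDl.
Qed.
HB.instance Definition _ := GRing.Zmodule_isComPzRing.Build quot
  quot_mulA quot_mulC quot_mul1 quot_mulD.

Fact quot_proj_zmod_morphism : zmod_morphism quot_proj.
Proof. by move=> x y; rewrite /quot_proj !piE. Qed.
HB.instance Definition _ :=
  GRing.isZmodMorphism.Build R quot quot_proj quot_proj_zmod_morphism.
Fact quot_proj_monoid_morphism : monoid_morphism quot_proj.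
Proof. by split=> // x y; exact: quot_projM. Qed.
HB.instance Definition _ :=
  GRing.isMonoidMorphism.Build R quot quot_proj quot_proj_monoid_morphism.

End Quotient.

Section ResidueField.
Variables (R : comPzRingType) (m : maxideal R).

Definition residue_field := quot m.
HB.instance Definition _ := GRing.ComPzRing.on residue_field.

Fact residue_field_neq0 : 1 != 0 :> residue_field.
Proof.
apply/eqP ; rewrite -(rmorph1 (quot_proj m)) -(rmorph0 (quot_proj m)) => e.
have [/(_ e) + _] := quot_projP m 1 0.
by rewrite subr0; case: (max_idealP m).
Qed.
HB.instance Definition _ :=
  GRing.PzSemiRing_isNonZero.Build residue_field residue_field_neq0.

Fact residue_field_inv_exists (x : residue_field) :
  x != 0 -> exists y, y * x = 1.
Proof.
elim/quot_ind: x => x /eqP x0; apply: contrapT => noinv; apply: x0.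
rewrite -(rmorph0 (quot_proj m)).
have [_] := quot_projP m x 0; apply; rewrite subr0.
case: (max_idealP m) => _ /(_ (ideal_add m (ideal_span [:: x]))); apply.
- by move=> z mz J; apply; left.
- move=> h1; apply: noinv.
  suff [a [b [mb eb]]] : exists a b, m b /\ 1 = b + a * x.
    exists (quot_proj m a); apply/esym.
    rewrite -[1]/(quot_proj m 1) eb -[RHS]quot_projM.
    by apply/quot_projP; rewrite addrK.
  have @J : ideal R.
    exists [set z | exists a b, m b /\ z = b + a * x].
    + by exists 0, 0; rewrite mul0r addr0; split=> //; exact: ideal_has0.
    + move=> _ _ [a [b [mb ->]]] [a' [b' [mb' ->]]]; exists (a + a'), (b + b').
      by rewrite mulrDl addrACA; split=> //; exact: ideal_addP.
    + move=> c _ [a [b [mb ->]]]; exists (c * a), (c * b).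
      by rewrite mulrDr mulrA; split=> //; exact: ideal_mulP.
  apply: (h1 J) => z [mz|/(_ J)]; first by exists 0, z; rewrite mul0r addr0.
  apply => w; rewrite /= inE => /eqP ->; exists 1, 0.
  by rewrite mul1r add0r; split=> //; exact: ideal_has0.
- by move=> J; apply; right => L; apply; rewrite /= inE.
Qed.

Definition residue_field_inv (x : residue_field) : residue_field :=
  if pselect (x != 0) is left x0 then projT1 (cid (residue_field_inv_exists x0))
  else 0.

Fact residue_field_mulVf x : x != 0 -> residue_field_inv x * x = 1.
Proof.
rewrite /residue_field_inv => x0; case: pselect => // x0'.
by case: cid.
Qed.
Fact residue_field_inv0 : residue_field_inv 0 = 0.
Proof. by rewrite /residue_field_inv; case: pselect => // h; case/eqP: (h). Qed.
HB.instance Definition _ := GRing.ComNzRing_isField.Build residue_field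
  residue_field_mulVf residue_field_inv0.

Definition residue (x : R) : residue_field := quot_proj m x.
HB.instance Definition _ := GRing.isZmodMorphism.Build R residue_field residue
  (@quot_proj_zmod_morphism R m).
HB.instance Definition _ := GRing.isMonoidMorphism.Build R residue_field residue
  (@quot_proj_monoid_morphism R m).

End ResidueField.


Section Localization.
Variables (R : comPzRingType) (p : primeideal R).

Definition loc_frac := {x : R * R | ~~ `[< p x.2 >]}.
Implicit Types u v w : loc_frac.

Lemma loc_denP u : ~ p (val u).2. Proof. by apply/asboolPn; exact: valP u. Qed.

Lemma loc_den1 : ~ p 1. Proof. by case: (prime_idealP p). Qed.

Lemma loc_denM x y : ~ p x -> ~ p y -> ~ p (x * y).
Proof. by move=> px py; case: (prime_idealP p) => _ /[apply] -[]. Qed.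

Definition mk_frac (a s : R) (ps : ~ p s) : loc_frac :=
  exist _ (a, s) (introT (asboolPn _) ps).

Definition loc_equiv u v : bool :=
  `[< exists2 t, ~ p t &
        t * ((val u).1 * (val v).2) = t * ((val v).1 * (val u).2) >].

Lemma loc_equiv_is_equiv : equiv_class_of loc_equiv.
Proof.
split=> [u|u v|v u w].
- by apply/asboolP; exists 1 => //; exact: loc_den1.
- by apply/asboolP/asboolP => -[t pt e]; exists t.
- move=> /asboolP[t pt e] /asboolP[t' pt' e']; apply/asboolP.
  exists (t * t' * (val v).2).
    by apply: loc_denM (@loc_denP v); exact: loc_denM.
  transitivity ((t * ((val u).1 * (val v).2)) * (t' * (val w).2)); first by ring.
  rewrite e.
  transitivity ((t' * ((val v).1 * (val w).2)) * (t * (val u).2)); first by ring.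
  by rewrite e'; ring.
Qed.

Canonical loc_equiv_equiv := EquivRelPack loc_equiv_is_equiv.
Canonical loc_encModRel := defaultEncModRel loc_equiv.

Definition loc := {eq_quot loc_equiv}.
HB.instance Definition _ := EqQuotient.on loc.
HB.instance Definition _ := Choice.on loc.

Definition loc_mk u : loc := \pi_loc u.

Lemma loc_mkP u v : loc_mk u = loc_mk v <->
  exists2 t, ~ p t & t * ((val u).1 * (val v).2) = t * ((val v).1 * (val u).2).
Proof.
rewrite /loc_mk; split=> [/eqP|uv]; last apply/eqP.
  by rewrite eqmodE => /asboolP.
by rewrite eqmodE; apply/asboolP.
Qed.

Lemma loc_ind (P : loc -> Prop) : (forall u, P (loc_mk u)) -> forall x, P x.
Proof. by move=> h x; rewrite -(reprK x); exact: h. Qed.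

Lemma loc_mk_eq u v :
  (val u).1 * (val v).2 = (val v).1 * (val u).2 -> loc_mk u = loc_mk v.
Proof. by move=> e; apply/loc_mkP; exists 1; [exact: loc_den1|rewrite e]. Qed.

Definition frac_add u v := mk_frac
  ((val u).1 * (val v).2 + (val v).1 * (val u).2)
  (loc_denM (@loc_denP u) (@loc_denP v)).
Definition frac_mul u v := mk_frac
  ((val u).1 * (val v).1) (loc_denM (@loc_denP u) (@loc_denP v)).
Definition frac_opp u := mk_frac (- (val u).1) (@loc_denP u).

Definition loc_add (x y : loc) := loc_mk (frac_add (repr x) (repr y)).
Definition loc_mul (x y : loc) := loc_mk (frac_mul (repr x) (repr y)).
Definition loc_opp (x : loc) := loc_mk (frac_opp (repr x)).
Definition loc_proj (a : R) : loc := loc_mk (mk_frac a loc_den1).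

Lemma loc_reprP u : exists2 t, ~ p t &
  t * ((val (repr (loc_mk u))).1 * (val u).2)
  = t * ((val u).1 * (val (repr (loc_mk u))).2).
Proof. by apply/loc_mkP; exact: reprK. Qed.

Lemma loc_addE u v : loc_add (loc_mk u) (loc_mk v) = loc_mk (frac_add u v).
Proof.
apply/loc_mkP; have [t pt e] := loc_reprP u; have [t' pt' e'] := loc_reprP v.
exists (t * t'); first exact: loc_denM.
move: (repr (loc_mk u)) (repr (loc_mk v)) e e' => u' v' e e' /=.
transitivity ((t * ((val u').1 * (val u).2)) * (t' * (val v').2 * (val v).2)
  + (t' * ((val v').1 * (val v).2)) * (t * (val u').2 * (val u).2)).
  by ring.
by rewrite e e'; ring.
Qed.

Lemma loc_mulE u v : loc_mul (loc_mk u) (loc_mk v) = loc_mk (frac_mul u v).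
Proof.
apply/loc_mkP; have [t pt e] := loc_reprP u; have [t' pt' e'] := loc_reprP v.
exists (t * t'); first exact: loc_denM.
move: (repr (loc_mk u)) (repr (loc_mk v)) e e' => u' v' e e' /=.
transitivity ((t * ((val u').1 * (val u).2)) * (t' * ((val v').1 * (val v).2))).
  by ring.
by rewrite e e'; ring.
Qed.

Lemma loc_oppE u : loc_opp (loc_mk u) = loc_mk (frac_opp u).
Proof.
apply/loc_mkP; have [t pt e] := loc_reprP u; exists t => //=.
by rewrite !mulNr !mulrN e.
Qed.

Fact loc_addA : associative loc_add.
Proof.
elim/loc_ind=> u; elim/loc_ind=> v; elim/loc_ind=> w.
by rewrite !loc_addE; apply: loc_mk_eq => /=; ring.
Qed.
Fact loc_addC : commutative loc_add.
Proof.
elim/loc_ind=> u; elim/loc_ind=> v.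
by rewrite !loc_addE; apply: loc_mk_eq => /=; ring.
Qed.
Fact loc_add0 : left_id (loc_proj 0) loc_add.
Proof.
by elim/loc_ind=> u; rewrite !loc_addE; apply: loc_mk_eq => /=; ring.
Qed.
Fact loc_addN : left_inverse (loc_proj 0) loc_opp loc_add.
Proof.
elim/loc_ind=> u; rewrite loc_oppE !loc_addE; apply: loc_mk_eq => /=; ring.
Qed.
Fact loc_mulA : associative loc_mul.
Proof.
elim/loc_ind=> u; elim/loc_ind=> v; elim/loc_ind=> w.
by rewrite !loc_mulE; apply: loc_mk_eq => /=; ring.
Qed.
Fact loc_mulC : commutative loc_mul.
Proof.
elim/loc_ind=> u; elim/loc_ind=> v.
by rewrite !loc_mulE; apply: loc_mk_eq => /=; ring.
Qed.
Fact loc_mul1 : left_id (loc_proj 1) loc_mul.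
Proof.
by elim/loc_ind=> u; rewrite !loc_mulE; apply: loc_mk_eq => /=; ring.
Qed.
Fact loc_mulDl : left_distributive loc_mul loc_add.
Proof.
elim/loc_ind=> u; elim/loc_ind=> v; elim/loc_ind=> w.
by rewrite !(loc_mulE, loc_addE); apply: loc_mk_eq => /=; ring.
Qed.

HB.instance Definition _ := GRing.isZmodule.Build loc
  loc_addA loc_addC loc_add0 loc_addN.
HB.instance Definition _ := GRing.Zmodule_isComPzRing.Build loc
  loc_mulA loc_mulC loc_mul1 loc_mulDl.

(* I R_p *)
Definition loc_ideal (I : ideal R) : ideal loc := ideal_ext loc_proj I.

End Localization.

Section KrullDimension.
Variable A : comPzRingType.

(* A chain p_0 < ... < p_n of n + 1 prime ideals has length n. *)
Definition has_prime_chain (n : nat) :=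
  exists q : 'I_n.+1 -> primeideal A,
    forall i j : 'I_n.+1, (i < j)%N -> (q i : set A) `<` q j.

Definition has_krull_dim (n : nat) :=
  has_prime_chain n /\ forall k, has_prime_chain k -> (k <= n)%N.

End KrullDimension.
Arguments has_krull_dim A n : clear implicits.

Section Depth.
Variable A : comPzRingType.

Definition regular_sequence (s : seq A) :=
  is_proper (ideal_span s) /\
  forall i, (i < size s)%N -> forall b,
    ideal_span (take i s) (s`_i * b) -> ideal_span (take i s) b.

(* Only used for local rings, where a regular sequence lies in the maximal
   ideal because it generates a proper ideal. *)
Definition has_depth (n : nat) :=
  (exists2 s : seq A, regular_sequence s & size s = n) /\
  forall s : seq A, regular_sequence s -> (size s <= n)%N.

(* For A local Noetherian, or zero: the zero ring is Cohen-Macaulay. *)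
Definition cohen_macaulay :=
  1 = 0 :> A \/ exists n, has_krull_dim A n /\ has_depth n.

End Depth.
Arguments regular_sequence {A} s.
Arguments has_depth A n : clear implicits.
Arguments cohen_macaulay A : clear implicits.

(* The length of the module L / N is at most n, for ideals N <= L: the
   submodules of L / N are the ideals between N and L. *)
Definition length_le (A : comPzRingType) (L N : ideal A) (n : nat) :=
  forall k (c : 'I_k.+1 -> ideal A),
    (forall i, N `<=` c i /\ c i `<=` L) ->
    (forall i j : 'I_k.+1, (i < j)%N -> (c i : set A) `<` c j) ->
    (k <= n)%N.

Section Rees.
Variables (R : comNzRingType) (I : ideal R).

Definition rees_pred : {pred {poly R}} :=
  fun f => `[< forall i, ideal_exp I i f`_i >].

Lemma ideal_exp_mul i j a b :
  ideal_exp I i a -> ideal_exp I j b -> ideal_exp I (i + j) (a * b).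
Proof.
elim: i a => [|i IHi] a.
  by move=> _ Ib; exact: ideal_mulP.
rewrite addSn => Ia Ib.
have @K : ideal R.
  exists [set z | ideal_exp I (i + j).+1 (z * b)].
  - by rewrite /= mul0r; exact: (ideal_has0 (ideal_exp I (i + j).+1)).
  - by move=> z w Kz Kw; rewrite /= mulrDl; exact: (ideal_addP Kz Kw).
  - by move=> c z Kz; rewrite /= -mulrA; exact: (ideal_mulP c Kz).
apply: (Ia K) => _ [x [y [Ix Iy ->]]] /=; rewrite -mulrA => J; apply.
by exists x, (y * b); split=> //; exact: IHi.
Qed.

Fact rees_subring_closed : subring_closed rees_pred.
Proof.
split=> [|f g|f g].
- by apply/asboolP => -[|i] //; rewrite coef1; exact: (ideal_has0 (ideal_exp I i.+1)).
- move=> /asboolP If /asboolP Ig; apply/asboolP => i; rewrite coefB.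
  by apply: ideal_addP => //; rewrite -mulN1r; exact: ideal_mulP.
- move=> /asboolP If /asboolP Ig; apply/asboolP => i; rewrite coefM.
  apply: (big_ind (ideal_exp I i)); first exact: ideal_has0.
    exact: ideal_addP.
  by move=> j _; rewrite -{1}(subnKC (ltn_ord j : (j <= i)%N)); exact: ideal_exp_mul.
Qed.
HB.instance Definition _ :=
  GRing.isSubringClosed.Build {poly R} rees_pred rees_subring_closed.

(* The Rees algebra R[It], with t the variable of {poly R}. *)
Record rees := ReesElement {
  rees_poly :> {poly R};
  rees_polyP : rees_poly \in rees_pred }.
HB.instance Definition _ := [isSub for rees_poly].
HB.instance Definition _ := [Choice of rees by <:].
HB.instance Definition _ := [SubChoice_isSubComNzRing of rees by <:].

Fact rees_constP (a : R) : a%:P \in rees_pred.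
Proof.
apply/asboolP => -[|i] //; rewrite coefC; exact: (ideal_has0 (ideal_exp I i.+1)).
Qed.
Definition rees_const (a : R) : rees := ReesElement (rees_constP a).

(* R[It] / m R[It], the direct sum of the I^n / m I^n. *)
Definition special_fiber (m : ideal R) := quot (ideal_ext rees_const m).

End Rees.

Definition has_analytic_spread (R : comNzRingType) (m : maxideal R)
    (I : ideal R) (l : nat) :=
  has_krull_dim (special_fiber I m) l.

Section Reductions.
Variable R : comPzRingType.
Implicit Types I J : ideal R.

Definition reduction J I :=
  J `<=` I /\ exists n, (I ^+ n.+1 = J * I ^+ n)%ideal.

Definition minimal_reduction J I :=
  reduction J I /\ forall J', reduction J' I -> J' `<=` J -> J' = J.

End Reductions.

Section ResidualIntersections.
Variable R : comPzRingType.
Implicit Types (I : ideal R) (x : seq R) (p : primeideal R).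

Definition G_condition I (t : nat) :=
  forall p i, I `<=` p -> has_krull_dim (loc p) i -> (i < t)%N ->
    exists g : i.-tuple (loc p), loc_ideal p I = ideal_span g.

(* With H the ideal generated by x, and t the number of terms of x, this says
   that H : I is a t-residual intersection of I.  The bound dim R_p <= t - 1
   is written dim R_p < t to cover t = 0. *)
Definition residual_intersection x I :=
  [set` x] `<=` I /\
  forall p i, has_krull_dim (loc p) i -> (i < size x)%N ->
    loc_ideal p I = loc_ideal p (ideal_span x).

Definition geometric_residual_intersection x I :=
  residual_intersection x I /\
  forall p i, I `<=` p -> has_krull_dim (loc p) i -> (i <= size x)%N ->
    loc_ideal p I = loc_ideal p (ideal_span x).

(* AN_t^-, for an integer t *)
Definition AN_minus I (t : int) :=
  forall (i : nat) (x : i.-tuple R), (i%:Z <= t)%R ->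
    geometric_residual_intersection x I ->
    cohen_macaulay (quot (ideal_colon (ideal_span x) I)).

End ResidualIntersections.

Section Zariski.
Variables (k : fieldType) (n : nat).

Definition zero_locus (S : set (mpoly.mpoly n k)) : set ('I_n -> k) :=
  [set v | forall f, S f -> mpoly.meval v f = 0].

Definition zariski_open (U : set ('I_n -> k)) :=
  exists S, U = ~` zero_locus S.

Definition zariski_dense (U : set ('I_n -> k)) :=
  forall V, zariski_open V -> V !=set0 -> U `&` V !=set0.

End Zariski.

(* The property Q holds for t general elements of the ideal generated by a. *)
Definition for_general_elements (R : comNzRingType) (m : maxideal R)
    (a : seq R) (t : nat) (Q : t.-tuple R -> Prop) :=
  exists U : set ('I_(t * size a) -> residue_field m),
    [/\ zariski_open U, zariski_dense U &
      forall c : 'M[R]_(t, size a),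
        U (fun e => mxvec (map_mx (residue m) c) 0 e) ->
        Q [tuple \sum_(j < size a) c i j * a`_j | i < t]].

Section JStretched.
Variables (R : comNzRingType) (m : maxideal R).

(* Tuples are indexed from 0: x_1, ..., x_(d-1) are [take d.-1 x], and x_d is
   [x`_d.-1].  The property is required for every choice of generators of I. *)
Definition j_stretched (d : nat) (I : ideal R) :=
  forall a : seq R, I = ideal_span a ->
  for_general_elements m a (fun x : d.-tuple R =>
    let K := ideal_sat (ideal_span (take d.-1 x)) I in
    let xd := quot_proj K x`_d.-1 in
    let Ibar := ideal_ext (quot_proj K) I in
    length_le (Ibar ^+ 2) (ideal_span [:: xd] * Ibar + Ibar ^+ 3) 1).

End JStretched.

(* Main.v *)
(* Write H = (y_1, ..., y_d) and J = (x_1, ..., x_d).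

   Under either hypothesis (H_{d-1} : I^oo) cap I^2 is contained in H I, so the
   length assumption says that I^2/(H I + I^3) has length at most one. In case
   (i) this holds because y_d is regular modulo H_{d-1}. In case (ii) general
   generators z_1, ..., z_{d-1} of H_{d-1} give geometric residual intersections
   K_i = Z_i : I for all i < d; with the Cohen-Macaulayness of R/K_i one finds
   depth R/Z_i >= d - i, Z_i : z_{i+1} = K_i, K_i cap I = Z_i and
   depth R/(I + K_i) >= 1. So Z_{d-1}/Z_{d-1} I has no socle, while
   (Z_{d-1} cap I^2)/Z_{d-1} I is supported at m.

   It remains to deform H to J. That I^2/(J I + I^3) is generated by an element
   w killed by m can be certified by determinants which are polynomials in the
   coefficients of x_1, ..., x_d: one of them is a unit, and the others generate
   an ideal containing m. The second condition only concerns these polynomials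
   modulo m^2. If one of them is nonzero modulo m, then it is a unit generically;
   otherwise all their coefficients are in m, so that modulo m^2 their values
   depend only on the residues of the coefficients, and spanning m/m^2 is an open
   condition on them. *)

Require Import Defs.
From mathcomp Require Import all_boot all_algebra.
From mathcomp Require Import boolp classical_sets cardinality.
From mathcomp Require Import mpoly.
From mathcomp Require Import ring.

Set Implicit Arguments.
Unset Strict Implicit.
Unset Printing Implicit Defensive.

Import GRing.Theory.

Local Open Scope classical_set_scope.
Local Open Scope ring_scope.

(** * Ideals *)

(** Hypotheses (i) and (ii) serve only to control the saturation at H. For general x, the elements
    x_1, ..., x_(d-1) vanish in R/(J_(d-1) : I^oo), so the module in the definition of j-stretched
    is a quotient of I^2/(J I + I^3), and nothing about the saturation of J_(d-1) has to be known.
    The obstacle in the deformation is that J I + I^3 depends on coefficients in R, while openness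
    concerns their residues; and I^2/I^3 need not have finite length, so that killing by m is not a
    rank condition over k. The determinants arise as follows. Relations between generators b of I^2
    modulo H I + I^3 extend to relations for all J, and by Cramer's rule a square matrix of
    relations has an annihilator as determinant. From b = C w comes 1 - C w, with determinant 1 - u
    where u = w C; using s w = 0 for s in m changes it to 1 - (1 - s) u. The two determinants
    generate an ideal containing s. The z_i are taken in y_i + (y_(i+1), ..., y_(d-1)), which
    preserves H_(d-1): only this ideal, not its partial spans, is known to be a residual
    intersection. Depth is treated by elements: positive depth is the absence of a socle. *)

Section DeleteNth.
Variables (T : eqType) (x0 : T) (s : seq T) (i : nat).

Definition delete_nth := (take i s ++ drop i.+1 s)%SEQ.

Lemma size_delete_nth : (i < size s)%N -> (size delete_nth).+1 = size s.
Proof. by move=> i_s; rewrite size_cat size_take size_drop i_s -addSn subnKC. Qed.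

Lemma mem_delete_nth x : x \in delete_nth -> x \in s.
Proof. by rewrite mem_cat => /orP[/mem_take|/mem_drop]. Qed.

Lemma nth_in_delete_nth k : (k < size s)%N -> k != i -> nth x0 s k \in delete_nth.
Proof.
move=> ks ki; rewrite mem_cat; move: ki; rewrite neq_ltn => /orP[k_i|i_k].
  rewrite -(nth_take x0 k_i) mem_nth ?orTb// size_take.
  by case: ifP => // _; exact: leq_trans k_i _.
have -> : nth x0 s k = nth x0 (drop i.+1 s) (k - i.+1) by rewrite nth_drop subnKC.
by rewrite orbC mem_nth// size_drop ltn_sub2r// (leq_ltn_trans i_k).
Qed.

End DeleteNth.

Section IdealArithmetic.
Variable R : comPzRingType.
Implicit Types (I J L : ideal R) (s : seq R) (x y z : R).

Lemma ideal_eqP I J : (forall z, I z <-> J z) -> I = J.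
Proof. by move=> IJ; apply/ideal_eq/predeqP => z; exact: IJ. Qed.

Lemma ideal_mulPr I x a : I x -> I (x * a).
Proof. by rewrite mulrC; exact: ideal_mulP. Qed.

Lemma ideal_oppP I x : I x -> I (- x).
Proof. by rewrite -mulN1r; exact: ideal_mulP. Qed.

Lemma ideal_subP I x y : I x -> I y -> I (x - y).
Proof. by move=> Ix /ideal_oppP; exact: ideal_addP. Qed.

Lemma ideal_addKl I x y : I x -> I (x + y) -> I y.
Proof. by move=> Ix Ixy; rewrite -(addKr x y) addrC; exact: ideal_subP. Qed.

Lemma ideal_sumP I (T : Type) (r : seq T) (P : pred T) (F : T -> R) :
  (forall i, P i -> I (F i)) -> I (\sum_(i <- r | P i) F i).
Proof. by move=> h; apply: big_ind => //; [exact: ideal_has0|exact: ideal_addP]. Qed.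

Lemma sub_ideal_gen (A : set R) : A `<=` ideal_gen A.
Proof. by move=> x Ax J; exact. Qed.

Lemma ideal_gen_min (A : set R) J : A `<=` J -> ideal_gen A `<=` J.
Proof. by move=> AJ x; exact. Qed.

Lemma mem_ideal_add I J z :
  (I + J)%ideal z <-> exists a b, [/\ I a, J b & z = a + b].
Proof.
split=> [|[a [b [Ia Jb ->]]]]; last first.
  by apply: ideal_addP; apply: sub_ideal_gen; [left|right].
have @K : ideal R.
  exists [set z | exists a b, [/\ I a, J b & z = a + b]].
  - by exists 0, 0; rewrite addr0; split=> //; exact: ideal_has0.
  - move=> _ _ [a [b [Ia Jb ->]]] [a' [b' [Ia' Jb' ->]]].
    by exists (a + a'), (b + b'); rewrite addrACA; split=> //; exact: ideal_addP.
  - move=> c _ [a [b [Ia Jb ->]]]; exists (c * a), (c * b).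
    by rewrite mulrDr; split=> //; exact: ideal_mulP.
move=> /(_ K); apply=> w [Iw|Jw].
  by exists w, 0; rewrite addr0; split=> //; exact: ideal_has0.
by exists 0, w; rewrite add0r; split=> //; exact: ideal_has0.
Qed.

Lemma ideal_add_subl I J : I `<=` (I + J)%ideal.
Proof. by move=> z Iz; apply: sub_ideal_gen; left. Qed.

Lemma ideal_add_subr I J : J `<=` (I + J)%ideal.
Proof. by move=> z Iz; apply: sub_ideal_gen; right. Qed.

Lemma ideal_add_min I J L : I `<=` L -> J `<=` L -> (I + J)%ideal `<=` L.
Proof. by move=> IL JL; apply: ideal_gen_min => z []; [exact: IL|exact: JL]. Qed.

Lemma mem_span_nil z : ideal_span [::] z <-> z = 0.
Proof.
split=> [|->]; last exact: ideal_has0.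
have @K : ideal R.
  exists [set z | z = 0] => [//|x y -> ->|a x ->]; first by rewrite /= addr0.
  by rewrite /= mulr0.
by move=> /(_ K); apply.
Qed.

Lemma mem_span_cons x s z :
  ideal_span (x :: s) z <-> exists a b, ideal_span s b /\ z = a * x + b.
Proof.
split=> [|[a [b [sb ->]]]]; last first.
  apply: ideal_addP.
    by apply: ideal_mulP; apply: sub_ideal_gen; rewrite /= mem_head.
  by move: b sb; apply: ideal_gen_min => w sw; apply: sub_ideal_gen;
     rewrite /= in_cons orbC (sw : w \in s).
have @K : ideal R.
  exists [set z | exists a b, ideal_span s b /\ z = a * x + b].
  - by exists 0, 0; rewrite mul0r addr0; split=> //; exact: ideal_has0.
  - move=> _ _ [a [b [Ib ->]]] [a' [b' [Ib' ->]]].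
    exists (a + a'), (b + b'); rewrite mulrDl addrACA.
    by split=> //; exact: ideal_addP.
  - move=> c _ [a [b [Ib ->]]]; exists (c * a), (c * b).
    by rewrite mulrDr mulrA; split=> //; exact: ideal_mulP.
move=> /(_ K); apply=> w sw; move: (sw : w \in x :: s).
rewrite in_cons => /predU1P[->|{}sw].
  by exists 1, 0; rewrite mul1r addr0; split=> //; exact: ideal_has0.
by exists 0, w; rewrite mul0r add0r; split=> //; exact: sub_ideal_gen.
Qed.

Lemma mem_span1 x z : ideal_span [:: x] z <-> exists a, z = a * x.
Proof.
rewrite mem_span_cons; split=> [[a [b [/mem_span_nil -> ->]]]|[a ->]].
  by exists a; rewrite addr0.
by exists a, 0; rewrite addr0; split=> //; exact: ideal_has0.
Qed.

Lemma mem_span s z :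
  ideal_span s z <-> exists c : nat -> R, z = \sum_(i < size s) c i * s`_i.
Proof.
split=> [|[c ->]]; last first.
  by apply: ideal_sumP => i _; apply: ideal_mulP; apply: sub_ideal_gen;
     rewrite /= mem_nth.
elim: s z => [z /mem_span_nil ->|x s IHs z /mem_span_cons[a [b [/IHs[c ->] ->]]]].
  by exists (fun=> 0); rewrite big_ord0.
by exists (fun i => if i is i'.+1 then c i' else a); rewrite big_ord_recl.
Qed.

Lemma span_mem s x : x \in s -> ideal_span s x.
Proof. exact: sub_ideal_gen. Qed.

Lemma span_nth s i : (i < size s)%N -> ideal_span s s`_i.
Proof. by move=> si; apply/span_mem/mem_nth. Qed.

Lemma span_min s J : (forall x, x \in s -> J x) -> ideal_span s `<=` J.
Proof. by move=> sJ; apply: ideal_gen_min => x; exact: sJ. Qed.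

Lemma span_cat s t : ideal_span (s ++ t) = (ideal_span s + ideal_span t)%ideal.
Proof.
apply: ideal_eqP => z; split; move: z.
  apply: span_min => x; rewrite mem_cat => /orP[] /span_mem.
    exact: ideal_add_subl.
  exact: ideal_add_subr.
apply: ideal_add_min; apply: span_min => x sx; apply: span_mem.
  by rewrite mem_cat sx.
by rewrite mem_cat orbC sx.
Qed.

Lemma ideal_mul_mem I J a b : I a -> J b -> (I * J)%ideal (a * b).
Proof. by move=> Ia Jb; apply: sub_ideal_gen; exists a, b. Qed.

Lemma ideal_mul_min I J L :
  (forall a b, I a -> J b -> L (a * b)) -> (I * J)%ideal `<=` L.
Proof. by move=> h; apply: ideal_gen_min => _ [a [b [Ia Jb ->]]]; exact: h. Qed.

Lemma ideal_mul_subr I J : (I * J)%ideal `<=` J.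
Proof. by apply: ideal_mul_min => a b _ Jb; exact: ideal_mulP. Qed.

Lemma ideal_mul_subl I J : (I * J)%ideal `<=` I.
Proof. by apply: ideal_mul_min => a b Ia _; exact: ideal_mulPr. Qed.

Lemma ideal_mulC I J : (I * J)%ideal = (J * I)%ideal.
Proof.
by apply: ideal_eqP => z; split; move: z; apply: ideal_mul_min => a b Ia Jb;
   rewrite mulrC; exact: ideal_mul_mem.
Qed.

Lemma mem_span_mul s I z : (ideal_span s * I)%ideal z <->
  exists c : nat -> R, (forall i, I (c i)) /\ z = \sum_(i < size s) c i * s`_i.
Proof.
split=> [|[c [Ic ->]]]; last first.
  apply: ideal_sumP => i _; rewrite mulrC.
  by apply: ideal_mul_mem => //; exact: span_nth.
have @K : ideal R.
  exists [set z | exists c : nat -> R,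
     (forall i, I (c i)) /\ z = \sum_(i < size s) c i * s`_i].
  - exists (fun=> 0); split=> [i|]; first exact: ideal_has0.
    by rewrite big1// => i _; rewrite mul0r.
  - move=> _ _ [c [Ic ->]] [c' [Ic' ->]]; exists (fun i => c i + c' i).
    split=> [i|]; first exact: ideal_addP.
    by rewrite -big_split; apply: eq_bigr => i _; rewrite mulrDl.
  - move=> a _ [c [Ic ->]]; exists (fun i => a * c i).
    split=> [i|]; first exact: ideal_mulP.
    by rewrite mulr_sumr; apply: eq_bigr => i _; rewrite mulrA.
move: z; apply: (@ideal_mul_min _ _ K) => _ b /mem_span[c ->] Ib.
exists (fun i => c i * b); split=> [i|]; first exact: ideal_mulP.
by rewrite mulr_suml; apply: eq_bigr => i _; rewrite mulrAC.
Qed.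

Lemma ideal_exp1 I : (I ^+ 1)%ideal = I.
Proof.
apply: ideal_eqP => z; split=> [|Iz]; first exact: ideal_mul_subl.
by rewrite -[z]mulr1; exact: ideal_mul_mem.
Qed.

Lemma ideal_exp2 I : (I ^+ 2)%ideal = (I * I)%ideal.
Proof. by rewrite -[in RHS](ideal_exp1 I) [in X in (X * _)%ideal]ideal_exp1. Qed.

Lemma ideal_exp_sub1 I n : (0 < n)%N -> (I ^+ n)%ideal `<=` I.
Proof. by move=> n0; rewrite -[X in _ `<=` ideal_set X]ideal_exp1; exact: ideal_exp_sub. Qed.

Lemma mem_ideal_expX I x n : I x -> (I ^+ n)%ideal (x ^+ n).
Proof. by move=> Ix; elim: n => // n IHn; rewrite exprS; exact: ideal_mul_mem. Qed.

Lemma prime_expX (p : primeideal R) x n : p (x ^+ n) -> p x.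
Proof.
case: (prime_idealP p) => p1 pM; elim: n => [/p1//|n IHn].
by rewrite exprS => /pM[].
Qed.

Lemma primeM (p : primeideal R) x y : p (x * y) -> p x \/ p y.
Proof. by case: (prime_idealP p) => _; exact. Qed.

Lemma prime_mul_sub (p : primeideal R) I J :
  (I * J)%ideal `<=` p -> I `<=` p \/ J `<=` p.
Proof.
move=> h; have [|/existsNP[a /not_implyP[Ia pa]]] := pselect (I `<=` p); first by left.
by right=> b Jb; have /primeM[] := h _ (ideal_mul_mem Ia Jb).
Qed.

Lemma prime_exp_sub (p : primeideal R) I n : (I ^+ n)%ideal `<=` p -> I `<=` p.
Proof.
case: (prime_idealP p) => p1 _; elim: n => [/(_ 1 Logic.I) //|n IHn].
by case/prime_mul_sub.
Qed.

Definition ideal_adj L x : ideal R := (L + ideal_span [:: x])%ideal.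

Lemma mem_adj L x z : ideal_adj L x z <-> exists l a, L l /\ z = l + a * x.
Proof.
rewrite mem_ideal_add; split=> [[l [b [Ll /mem_span1[a ->] ->]]]|[l [a [Ll ->]]]].
  by exists l, a.
by exists l, (a * x); split=> //; apply/mem_span1; exists a.
Qed.

Lemma adj_sub L x : L `<=` ideal_adj L x. Proof. exact: ideal_add_subl. Qed.

Lemma adj_mem L x a : ideal_adj L x (a * x).
Proof. by apply: ideal_add_subr; apply/mem_span1; exists a. Qed.

Lemma adj_id L x : ideal_adj L x x.
Proof. by rewrite -[X in ideal_set _ X]mul1r; exact: adj_mem. Qed.

Lemma adj_min L x J : L `<=` J -> J x -> ideal_adj L x `<=` J.
Proof.
move=> LJ Jx z /mem_adj[l [a [Ll ->]]].
by apply: ideal_addP; [exact: LJ|exact: ideal_mulP].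
Qed.

Lemma adjC L x y : ideal_adj (ideal_adj L x) y = ideal_adj (ideal_adj L y) x.
Proof.
by apply: ideal_eqP => z; split; move: z; apply: adj_min;
   by [apply: adj_min; [apply: subset_trans (@adj_sub _ _)|exact: adj_id]; exact: adj_sub
      |apply: adj_sub; exact: adj_id].
Qed.

Lemma add_span_cons L x s :
  (L + ideal_span (x :: s))%ideal = (ideal_adj L x + ideal_span s)%ideal.
Proof.
rewrite -cat1s span_cat; apply: ideal_eqP => z; split; move: z.
  apply: ideal_add_min.
    by apply: subset_trans (@ideal_add_subl _ _); exact: adj_sub.
  apply: ideal_add_min; last exact: ideal_add_subr.
  by apply: subset_trans (@ideal_add_subl _ _); exact: ideal_add_subr.
apply: ideal_add_min.
  apply: ideal_add_min; first exact: ideal_add_subl.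
  by apply: subset_trans (@ideal_add_subr _ _); exact: ideal_add_subl.
by apply: subset_trans (@ideal_add_subr _ _); exact: ideal_add_subr.
Qed.

Lemma adj_add_span L x s :
  ideal_adj (L + ideal_span s) x = (ideal_adj L x + ideal_span s)%ideal.
Proof.
apply: ideal_eqP => z; split; move: z.
  apply: adj_min; last by apply: ideal_add_subl; exact: adj_id.
  apply: ideal_add_min; last exact: ideal_add_subr.
  by apply: subset_trans (@ideal_add_subl _ _); exact: adj_sub.
apply: ideal_add_min; last first.
  by apply: subset_trans (@adj_sub _ _); exact: ideal_add_subr.
apply: adj_min; last exact: adj_id.
by apply: subset_trans (@adj_sub _ _); exact: ideal_add_subl.
Qed.

Lemma span_rcons s x : ideal_span (rcons s x) = ideal_adj (ideal_span s) x.
Proof. by rewrite -cats1 span_cat. Qed.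

Definition regular_mod L x := forall b, L (x * b) -> L b.

Definition associated_at L (p : primeideal R) u := forall b, p b <-> L (b * u).

Lemma associated_sub L p u : associated_at L p u -> L `<=` p.
Proof. by move=> pu b Lb; apply/pu; exact: ideal_mulPr. Qed.

Lemma associated_notin L p u : associated_at L p u -> ~ L u.
Proof.
by move=> pu Lu; have [+ _] := prime_idealP p; apply; apply/pu; rewrite mul1r.
Qed.

Lemma associated_mul L p u a : associated_at L p u -> ~ p a ->
  associated_at L p (a * u).
Proof.
move=> pu pa b; rewrite mulrA -pu; split=> [pb|/primeM[]//]; exact: ideal_mulPr.
Qed.

End IdealArithmetic.

(** * Associated and minimal primes *)

Section Noetherian.
Variable R : comPzRingType.
Hypothesis R_noetherian : noetherian R.
Implicit Types (I J L : ideal R).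

(** Otherwise every counterexample lies strictly below another one. The union of the resulting
    ascending chain is finitely generated, hence already equal to a member of the chain. *)
Lemma noetherian_ind (P : ideal R -> Prop) :
  (forall L, (forall L', L `<` L' -> P L') -> P L) -> forall L, P L.
Proof.
move=> IH L0; apply: contrapT => nP0.
pose T := {L | ~ P L}.
have nxt (L : T) : {L' : T | projT1 L `<` projT1 L'}.
  apply: cid; case: L => L nPL /=; apply: contrapT => h; apply: nPL; apply: IH => L' LL'.
  by apply: contrapT => nPL'; apply: h; exists (exist _ L' nPL').
pose c := fix c n : T := if n is n'.+1 then projT1 (nxt (c n')) else exist _ L0 nP0.
have cS n : projT1 (c n) `<` projT1 (c n.+1) by exact: projT2 (nxt (c n)).
have cle i j : (i <= j)%N -> projT1 (c i) `<=` projT1 (c j).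
  move/subnK <-; elim: (j - i)%N => // n IHn.
  by rewrite addSn; apply: subset_trans IHn _; exact: properW (cS _).
have @U : ideal R.
  exists [set x | exists n, projT1 (c n) x].
  - by exists 0; exact: ideal_has0.
  - move=> x y [i ci] [j cj]; exists (maxn i j); apply: ideal_addP.
      by apply: (cle _ _ _ _ ci); rewrite leq_maxl.
    by apply: (cle _ _ _ _ cj); rewrite leq_maxr.
  - by move=> a x [i ci]; exists i; exact: ideal_mulP.
have [s Us] := R_noetherian U.
have [n cn] : exists n, forall x, x \in s -> projT1 (c n) x.
  have : forall x, x \in s -> U x by move=> x /span_mem; rewrite -Us.
  elim: (s) => [_|x t IHt tU]; first by exists 0.
  have [|n cn] := IHt; first by move=> y ty; apply: tU; rewrite in_cons ty orbT.
  have [i ci] := tU x (mem_head _ _); exists (maxn i n) => y.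
  rewrite in_cons => /predU1P[->|ty]; first by apply: (cle _ _ _ _ ci); rewrite leq_maxl.
  by apply: (cle _ _ _ _ (cn y ty)); rewrite leq_maxr.
have [_] := cS n; apply=> x cx.
have : U x by exists n.+1.
by rewrite Us; exact: span_min cn x.
Qed.

Lemma prime_of_maximal (m : maxideal R) : is_prime m.
Proof.
have [m1 mmax] := max_idealP m; split=> // x y mxy.
apply: contrapT => /not_orP[nx ny].
have h z : ~ m z -> ideal_adj m z 1.
  move=> nz; apply: contrapT => h1; apply: nz.
  by apply: (mmax (ideal_adj m z)) => //; [exact: adj_sub|exact: adj_id].
have /mem_adj[a [b [ma e]]] := h _ nx.
have /mem_adj[a' [b' [ma' e']]] := h _ ny.
apply: m1; rewrite -[1]mulr1 {1}e e'.
have -> : (a + b * x) * (a' + b' * y)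
  = (a' + b' * y) * a + (b * x) * a' + b * b' * (x * y) by ring.
by apply: ideal_addP; [apply: ideal_addP|]; exact: ideal_mulP.
Qed.

Lemma sub_maximal L : is_proper L -> exists n : maxideal R, L `<=` n.
Proof.
elim/noetherian_ind: L => L IH L1.
have [Lmax|/existsNP[J /not_implyP[LJ /not_implyP[J1 nJL]]]] :=
    pselect (forall J, L `<=` J -> is_proper J -> J `<=` L).
  by exists (MaxIdeal (conj L1 Lmax)).
have [//||n Jn] := IH J => //.
by exists n; apply: subset_trans Jn.
Qed.

(* Among the multiples of [u] outside [L], one has a maximal annihilator. *)
Lemma associated_exists L u : ~ L u ->
  exists (p : primeideal R) (r : R), associated_at L p (r * u).
Proof.
move=> Lu.
pose ann r : ideal R := ideal_colon L (ideal_span [:: r * u]).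
have annE r b : ann r b <-> L (b * (r * u)).
  split=> [|Lb x /mem_span1[a ->]]; first by apply; exact: span_mem (mem_head _ _).
  by rewrite mulrCA; exact: ideal_mulP.
suff h A : forall r, A = ann r -> ~ L (r * u) ->
    exists (p : primeideal R) (r : R), associated_at L p (r * u).
  by apply: (h (ann 1) 1) => //; rewrite mul1r.
elim/noetherian_ind: A => A IH r eA Lru.
have [Ap|nAp] := pselect (is_prime A).
  by exists (PrimeIdeal Ap), r => b; rewrite /= eA; exact: annE.
have A1 : is_proper A by rewrite eA /is_proper annE mul1r.
have /existsNP[x /existsNP[y /not_implyP[Axy /not_orP[Ax Ay]]]] :
  ~ forall x y, A (x * y) -> A x \/ A y by move=> h; apply: nAp; split.
apply: (IH (ann (y * r)) _ (y * r)) => //; last first.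
  by move=> h; apply: Ay; rewrite eA annE mulrA.
split=> [b|/(_ x) h].
  rewrite eA !annE => Lb; rewrite -mulrA mulrCA; exact: ideal_mulP.
by apply: Ax; apply: h; rewrite annE -mulrA mulrA -annE -eA.
Qed.

Lemma associated_of_zerodiv L x b : L (x * b) -> ~ L b ->
  exists (p : primeideal R) r, p x /\ associated_at L p (r * b).
Proof.
move=> Lxb Lb; have [p [r pr]] := associated_exists Lb.
by exists p, r; split=> //; apply/pr; rewrite mulrCA; exact: ideal_mulP.
Qed.

(** If p is the annihilator of u modulo L, then (L + (u))/L is R/p, all of whose nonzero elements
    have annihilator p. So an associated prime q of L, the annihilator of w, is p as soon as a
    multiple a w with a outside q falls into L + (u); otherwise q is associated to L + (u), and
    induction applies. *)
Lemma associated_finite L : exists S : seq (ideal R),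
  forall p u, associated_at L p u -> List.In (p : ideal R) S.
Proof.
elim/noetherian_ind: L => L IH.
have [[v Lv]|Lall] := pselect (exists v, ~ L v); last first.
  by exists [::] => p u /associated_notin Lu; apply: Lall; exists u.
have [p [r pr]] := associated_exists Lv; set u := r * v in pr.
have [|S hS] := IH (ideal_adj L u).
  split; first exact: adj_sub.
  by move=> /(_ u (@adj_id _ _ _)); exact: associated_notin pr.
exists ((p : ideal R) :: S) => q w qw.
have [[a [La pa]]|h] := pselect (exists a, ideal_adj L u (a * w) /\ ~ q a).
  have /mem_adj[l [c [Ll e]]] := La.
  left; apply: ideal_eqP => b; have pc : ~ p c.
    move=> /pr Lcu; apply: (associated_notin (associated_mul qw pa)).
    by rewrite e; exact: ideal_addP.
  rewrite (associated_mul qw pa b) (associated_mul pr pc b) e mulrDr.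
  split=> h; first by apply: ideal_addP => //; exact: ideal_mulP.
  by apply: ideal_addKl h; exact: ideal_mulP.
right; apply: (hS q w) => b; split=> [/qw|h']; first exact: adj_sub.
by apply: contrapT => qb; apply: h; exists b.
Qed.

(** If x y lies in L with neither factor in L, each prime minimal over L contains x or y and is then
    minimal over L + (x) or L + (y). *)
Lemma minimal_primes_finite L : exists S : seq (ideal R),
  forall p : primeideal R, L `<=` p ->
    (forall q : primeideal R, L `<=` q -> q `<=` p -> p `<=` q) ->
  List.In (p : ideal R) S.
Proof.
elim/noetherian_ind: L => L IH.
have [Lp|nLp] := pselect (is_prime L).
  exists [:: L] => p Lsub pmin; left; apply/ideal_eq/seteqP; split=> //.
  exact: (pmin (PrimeIdeal Lp)).
have [L1|nL1] := pselect (L 1).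
  by exists [::] => p /(_ _ L1) p1; have [] := prime_idealP p.
have /existsNP[x /existsNP[y /not_implyP[Lxy /not_orP[Lx Ly]]]] :
  ~ forall x y, L (x * y) -> L x \/ L y by move=> h; apply: nLp; split.
have adjp z : ~ L z -> L `<` ideal_adj L z.
  by move=> Lz; split; [exact: adj_sub|move=> /(_ z (@adj_id _ _ _))].
have [S hS] := IH _ (adjp _ Lx); have [T hT] := IH _ (adjp _ Ly).
exists (S ++ T)%SEQ => p Lsub pmin; apply/List.in_or_app.
have h z : p z -> ideal_adj L z `<=` p /\ forall q : primeideal R,
   ideal_adj L z `<=` q -> q `<=` p -> p `<=` q.
  move=> pz; split=> [|q Lq]; first exact: adj_min.
  by apply: pmin; apply: subset_trans Lq; exact: adj_sub.
case/primeM: (Lsub _ Lxy) => /h[h1 h2]; [left; exact: hS|right; exact: hT].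
Qed.

End Noetherian.
(** * Depth over a local ring with infinite residue field *)

Lemma infinite_notin (T : choiceType) (s : seq T) :
  infinite_set [set: T] -> exists x, x \notin s.
Proof.
move=> T_infinite; apply: contrapT => h; apply: T_infinite.
apply: (@sub_finite_set _ _ [set` s]); last exact: finite_seq.
by move=> x _; apply: contrapT => /negP xs; apply: h; exists x.
Qed.

Section LocalRing.
Variables (R : comPzRingType) (m : maxideal R).
Hypotheses (R_noetherian : noetherian R) (R_local : local_ring m).
Implicit Types (I J K L : ideal R).

Lemma local_proper L : is_proper L -> L `<=` m.
Proof. by move=> /(sub_maximal R_noetherian)[n]; rewrite (R_local n). Qed.

Lemma local_prime (p : primeideal R) : p `<=` m.
Proof. by apply: local_proper; case: (prime_idealP p). Qed.

Lemma max_proper : ~ m 1. Proof. by case: (max_idealP m). Qed.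

Lemma local_unit x : ~ m x -> exists y, y * x = 1.
Proof.
move=> mx; have [/mem_span1[y ->]|h] := pselect (ideal_span [:: x] 1).
  by exists y.
by case: mx; apply: (local_proper h); exact: span_mem (mem_head _ _).
Qed.

Definition prime_max : primeideal R := PrimeIdeal (prime_of_maximal m).

Lemma local_unitM x y L : ~ m x -> L (x * y) -> L y.
Proof.
by move=> /local_unit[z zx] Lxy; rewrite -[y]mul1r -zx -mulrA; exact: ideal_mulP.
Qed.

Lemma max_1B c : m c -> ~ m (1 - c).
Proof. by move=> mc /(ideal_addP mc); rewrite addrC subrK; exact: max_proper. Qed.

(** Generators of I are eliminated one at a time: in x = l + c x + u with c in m, the factor 1 - c
    is a unit. *)
Lemma nakayama I L : I `<=` (L + m * I)%ideal -> I `<=` L.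
Proof.
have [s -> h] := R_noetherian I.
have {h} : forall x, x \in s -> (L + m * ideal_span s)%ideal x.
  by move=> x /span_mem; exact: h.
have memS x t z : (m * ideal_span (x :: t))%ideal z ->
    exists c u, [/\ m c, (m * ideal_span t)%ideal u & z = c * x + u].
  rewrite ideal_mulC mem_span_mul => -[c [mc ->]]; rewrite big_ord_recl.
  exists (c 0), (\sum_(i < size t) c i.+1 * t`_i); split=> //.
  by rewrite ideal_mulC; apply/mem_span_mul; exists (fun i => c i.+1).
elim: s => [_ z /mem_span_nil ->|x s IHs hs]; first exact: ideal_has0.
pose N := (L + m * ideal_span s)%ideal.
have Nx : N x.
  have /mem_ideal_add[l [z [Ll /memS[c [u [mc mu ->]]]] e]] := hs x (mem_head _ _).
  apply: (local_unitM (max_1B mc)).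
  apply/mem_ideal_add; exists l, u; split=> //.
  by rewrite mulrBl mul1r {1}e; ring.
have sL : ideal_span s `<=` L.
  apply: IHs => z sz; have := hs z; rewrite in_cons sz orbT => /(_ isT).
  move=> /mem_ideal_add[l [w [Ll /memS[c [u [mc mu ->]]]] ->]].
  apply: ideal_addP; first exact: ideal_add_subl.
  by apply: ideal_addP; [exact: ideal_mulP|exact: ideal_add_subr].
apply: span_min => z; rewrite in_cons => /predU1P[->|/span_mem]; last exact: sL.
move: x {hs} Nx; apply: ideal_add_min => // z' /ideal_mul_subr; exact: sL.
Qed.

Section Depth.

(* [depth R/L >= n], where the zero module has infinite depth. *)
Fixpoint depth_ge (n : nat) (L : ideal R) : Prop :=
  if n is n'.+1 then
    exists x, [/\ m x, regular_mod L x & depth_ge n' (ideal_adj L x)]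
  else True.

Lemma depth_geS n L : depth_ge n.+1 L -> depth_ge n L.
Proof.
elim: n L => // n IHn L [x [mx Lx dx]].
by exists x; split=> //; exact: IHn.
Qed.

Lemma depth_ge_le n n' L : (n <= n')%N -> depth_ge n' L -> depth_ge n L.
Proof. by move=> /subnK <-; elim: (n' - n)%N => // i IHi /depth_geS. Qed.

Lemma depth_ge_one n : depth_ge n (ideal_one R).
Proof.
elim: n => // n IHn; exists 0; split=> //; first exact: ideal_has0.
by have -> // : ideal_adj (ideal_one R) 0 = ideal_one R
  by apply: ideal_eqP => z; split=> // _; exact: adj_sub.
Qed.

End Depth.

Section InfiniteResidueField.
Hypothesis k_infinite : infinite_set [set: residue_field m].

Lemma residue_eq x y : residue m x = residue m y <-> m (x - y).
Proof. exact: quot_projP. Qed.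

Lemma residue_eq0 x : residue m x = 0 <-> m x.
Proof. by rewrite -(rmorph0 (residue m)) residue_eq subr0. Qed.

Lemma residue_surj (c : residue_field m) : exists x, residue m x = c.
Proof. by exists (repr c); exact: quot_repr. Qed.

Lemma residue_avoid (bs : seq (residue_field m)) : exists t, residue m t \notin bs.
Proof.
have [c cbs] := infinite_notin bs k_infinite.
by have [t tc] := residue_surj c; exists t; rewrite tc.
Qed.

(* On the line [x + t w] an ideal that does not contain both [x] and [w]
   meets at most one residue class of parameters. *)
Lemma avoid_line (S : seq (ideal R)) x w :
  exists t, forall Q, List.In Q S -> Q (x + t * w) -> Q x /\ Q w.
Proof.
suff [bs h] : exists bs : seq (residue_field m), forall t,
    residue m t \notin bs -> forall Q, List.In Q S -> Q (x + t * w) -> Q x /\ Q w.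
  by have [t /h ?] := residue_avoid bs; exists t.
elim: S => [|Q S [bs h]]; first by exists [::].
have [[t0 [Qt0 nQ]]|good] := pselect (exists t0, Q (x + t0 * w) /\ ~ (Q x /\ Q w)).
  exists (residue m t0 :: bs) => t; rewrite in_cons negb_or => /andP[/eqP tt0 tbs].
  move=> Q' [<- Qt|]; last exact: h.
  exfalso; apply: nQ.
  have Qw : Q w.
    apply: (@local_unitM (t - t0)); first by move/residue_eq.
    have -> : (t - t0) * w = (x + t * w) - (x + t0 * w) by ring.
    exact: ideal_subP.
  split=> //; apply: (ideal_addKl (ideal_mulP t Qw)); by rewrite addrC.
exists bs => t tbs Q' [<- Qt|]; last exact: h.
by apply: contrapT => nQ; apply: good; exists t.
Qed.

(** Avoidance for arbitrary ideals: the infinite residue field takes over the part of primality.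
    This matters because it is also applied to the ideals [nongens], which need not be prime. *)
Lemma avoid_coset (S : seq (ideal R)) x (ws : seq R) :
  exists2 z, ideal_span ws (z - x) & forall Q, List.In Q S -> Q z ->
    Q x /\ forall w, w \in ws -> Q w.
Proof.
elim: ws => [|w ws [z zx hz]].
  by exists x; [rewrite subrr; exact: ideal_has0|].
have [t ht] := avoid_line S z w.
exists (z + t * w) => [|Q SQ /(ht _ SQ)[/(hz _ SQ)[Qx Qws] Qw]].
  by apply/mem_span_cons; exists t, (z - x); split=> //; rewrite addrAC addrC.
by split=> // v; rewrite in_cons => /predU1P[->|/Qws].
Qed.

(** A general combination of elements regular modulo the single ideals works: no associated prime of
    any of these ideals contains all of them. *)
Lemma regular_common (Ls : seq (ideal R)) :
  (forall L, List.In L Ls -> exists2 x, m x & regular_mod L x) ->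
  exists2 x, m x & forall L, List.In L Ls -> regular_mod L x.
Proof.
move=> hLs.
have [xs [mxs xsP]] : exists xs : seq R, (forall x, x \in xs -> m x) /\
    forall L, List.In L Ls -> exists2 x, x \in xs & regular_mod L x.
  elim: Ls hLs => [_|L Ls IH hLs]; first by exists [::].
  have [|xs [mxs xsP]] := IH; first by move=> L' L'Ls; apply: hLs; right.
  have [|x mx Lx] := hLs L; first by left.
  exists (x :: xs); split=> [y|L' [<-|/xsP[y yxs Ly]]].
  - by rewrite in_cons => /predU1P[->//|/mxs].
  - by exists x => //; rewrite mem_head.
  - by exists y => //; rewrite in_cons yxs orbT.
have [S hS] : exists S : seq (ideal R), forall L, List.In L Ls ->
    forall p u, associated_at L p u -> List.In (p : ideal R) S.
  elim: (Ls) => [|L Ls' [S hS]]; first by exists [::].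
  have [T hT] := associated_finite R_noetherian L.
  exists (T ++ S)%SEQ => L' [<- p u /hT|/hS h p u /h] hin;
    apply/List.in_or_app; [by left|by right].
pose ass (Q : ideal R) := exists L (p : primeideal R) u,
  [/\ List.In L Ls, Q = p :> ideal R & associated_at L p u].
pose S' := List.filter (fun Q => `[< ass Q >]) S.
have [z zxs hz] := avoid_coset S' 0 xs.
exists z => [|L LLs b Lzb].
  by rewrite -(subr0 z); exact: (span_min mxs).
apply: contrapT => Lb.
have [p [r [pz pr]]] := associated_of_zerodiv R_noetherian Lzb Lb.
have pS' : List.In (p : ideal R) S'.
  apply/List.filter_In; split; first exact: hS LLs _ _ pr.
  by apply/asboolP; exists L, p, (r * b).
have [_ pxs] := hz _ pS' pz.
have [x xxs Lx] := xsP L LLs.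
by apply: (associated_notin pr); apply: Lx; apply/pr; exact: pxs.
Qed.

(** An element with annihilator m would be in the socle, so no associated prime contains m, and a
    general element of m avoids them all. Together with [regular_socle], this makes positive depth a
    statement about socles. *)
Lemma socle_regular L : (forall u, (forall c, m c -> L (c * u)) -> L u) ->
  exists2 x, m x & regular_mod L x.
Proof.
move=> soc; have [s ms] := R_noetherian m.
have [S hS] := associated_finite R_noetherian L.
pose S' := List.filter
  (fun Q : ideal R => `[< exists (p : primeideal R) u,
     Q = p :> ideal R /\ associated_at L p u >]) S.
have [z zs hz] := avoid_coset S' 0 s.
exists z => [|b Lzb]; first by move: zs; rewrite subr0 ms.
apply: contrapT => Lb.
have [p [r [pz pr]]] := associated_of_zerodiv R_noetherian Lzb Lb.
have [|_ ps] := hz p _ pz.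
  apply/List.filter_In; split; first exact: hS pr.
  by apply/asboolP; exists p, (r * b).
apply: (associated_notin pr); apply: soc => c; rewrite ms => mc.
exact/pr/(span_min ps).
Qed.

Lemma regular_socle L x : m x -> regular_mod L x ->
  forall u, (forall c, m c -> L (c * u)) -> L u.
Proof. by move=> mx Lx u mu; exact/Lx/mu. Qed.

(** This half of exchanging x and y is formal. The other half, regularity of y modulo L itself,
    needs Nakayama and is part of [regular_list_rotate]. *)
Lemma regular_swap L x y : regular_mod L x -> regular_mod (ideal_adj L x) y ->
  regular_mod (ideal_adj L y) x.
Proof.
move=> Lx Ly b /mem_adj[l [a [Ll e]]].
have /mem_adj[l' [a' [Ll' e']]] : ideal_adj L x a.
  apply: Ly; have -> : y * a = b * x - l by rewrite [b * x]mulrC e; ring.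
  by apply: ideal_subP; [exact: adj_mem|exact: adj_sub].
apply/mem_adj; exists (b - a' * y), a'; split; last by rewrite subrK.
apply: Lx; rewrite mulrBr e e'.
have -> : l + (l' + a' * x) * y - x * (a' * y) = l + y * l' by ring.
by apply: ideal_addP => //; exact: ideal_mulP.
Qed.

(* Rees: the depth of [R/(L + x)] does not depend on the regular element. *)
Lemma depth_ge_adj_indep n L x y : m x -> m y -> regular_mod L x ->
  regular_mod L y -> depth_ge n (ideal_adj L x) -> depth_ge n (ideal_adj L y).
Proof.
elim: n L x y => // n IHn L x y mx my Lx Ly [z0 [mz0 Lz0 dz0]].
have [z1 mz1 Lz1] : exists2 z, m z & regular_mod (ideal_adj L y) z.
  (* The socles of R/(L + (x)) and R/(L + (y)) are both Ext^1(k, R/L); explicitly, u corresponds to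
     a when x u = a y modulo L. *)
  apply: socle_regular => u mu.
  have /mem_adj[l [a [Ll e]]] : ideal_adj L y (x * u) by apply: mu.
  have : ideal_adj L x a.
    apply: (regular_socle mz0 Lz0) => c mc.
    have /mem_adj[l' [a' [Ll' e']]] := mu _ mc.
    apply/mem_adj; exists (c * a - a' * x), a'; split; last by rewrite subrK.
    apply: Ly; have -> : y * (c * a - a' * x) = x * l' - c * l.
      transitivity (c * (x * u - l) - x * (c * u - l')); last by ring.
      by rewrite e e'; ring.
    by apply: ideal_subP; exact: ideal_mulP.
  move=> /mem_adj[l' [v [Ll' ea]]].
  apply/mem_adj; exists (u - v * y), v; split; last by rewrite subrK.
  apply: Lx; have -> : x * (u - v * y) = l + l' * y.
    by rewrite mulrBr e ea; ring.
  by apply: ideal_addP => //; exact: ideal_mulPr.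
(* A common regular element z can be moved in front of both x and y, so that the induction
   hypothesis applies to L + (z). *)
have [|z mz Lz] := @regular_common [:: ideal_adj L x; ideal_adj L y].
  by move=> L' [<-|[<-|[]]]; [exists z0|exists z1].
have Lxz : regular_mod (ideal_adj L x) z by apply: Lz; left.
have Lyz : regular_mod (ideal_adj L y) z by apply: Lz; right; left.
exists z; split=> //; rewrite adjC.
apply: (IHn _ x y) => //; [exact: regular_swap|exact: regular_swap|].
by rewrite adjC; exact: IHn dz0.
Qed.

Lemma depth_ge_adj n L x : m x -> regular_mod L x -> depth_ge n.+1 L ->
  depth_ge n (ideal_adj L x).
Proof. by move=> mx Lx [y [my Ly]]; exact: depth_ge_adj_indep. Qed.

Lemma depth_ge_regular n L : depth_ge n.+1 L -> exists2 x, m x & regular_mod L x.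
Proof. by case=> x [mx Lx _]; exists x. Qed.

(* The depth lemma for [0 -> R/K -z-> R/Z -> R/(Z + z) -> 0]. *)
Lemma depth_ge_cokernel n K (Z : ideal R) z : (forall b, K b <-> Z (z * b)) ->
  depth_ge n.+1 K -> depth_ge n Z -> depth_ge n (ideal_adj Z z).
Proof.
elim: n K Z z => // n IHn K Z z KZ dK dZ.
have [x1 mx1 Kx1] := depth_ge_regular dK.
have [x2 mx2 Zx2] := depth_ge_regular dZ.
have [x3 mx3 Cx3] : exists2 x, m x & regular_mod (ideal_adj Z z) x.
  have [|x mx KZx] := @regular_common [:: K; Z].
    by move=> L' [<-|[<-|[]]]; [exists x1|exists x2].
  have Kx : regular_mod K x by apply: KZx; left.
  have Zx : regular_mod Z x by apply: KZx; right; left.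
  have [y [my Ky _]] := depth_ge_adj mx Kx dK.
  (* The connecting map from the socle of the cokernel to Ext^1(k, R/K) sends u to a, where x u = a
     z modulo Z. Its target vanishes because R/K has depth at least two here. *)
  apply: socle_regular => u mu.
  have /mem_adj[l [a [Zl e]]] := mu x mx.
  have : ideal_adj K x a.
    apply: (regular_socle my Ky) => c mc.
    have /mem_adj[l' [a' [Zl' e']]] := mu c mc.
    apply/mem_adj; exists (c * a - a' * x), a'; split; last by rewrite subrK.
    apply/KZ; have -> : z * (c * a - a' * x) = x * l' - c * l.
      transitivity (c * (x * u - l) - x * (c * u - l')); last by ring.
      by rewrite e e'; ring.
    by apply: ideal_subP; exact: ideal_mulP.
  move=> /mem_adj[l' [v [Kl' ea]]].
  apply/mem_adj; exists (u - v * z), v; split; last by rewrite subrK.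
  apply: Zx; have -> : x * (u - v * z) = l + z * l'.
    by rewrite mulrBr e ea; ring.
  by apply: ideal_addP => //; exact/KZ.
have [|x mx hx] := @regular_common [:: K; Z; ideal_adj Z z].
  by move=> L' [<-|[<-|[<-|[]]]]; [exists x1|exists x2|exists x3].
have Kx : regular_mod K x by apply: hx; left.
have Zx : regular_mod Z x by apply: hx; right; left.
have Cx : regular_mod (ideal_adj Z z) x by apply: hx; right; right; left.
(* As x is also regular on the cokernel, the sequence stays exact modulo x, that is, (Z + (x)) : z =
   K + (x). *)
exists x; split=> //; rewrite adjC; apply: (IHn (ideal_adj K x)).
- move=> b; split=> [/mem_adj[l [a [Kl ->]]]|/mem_adj[l [a [Zl e]]]].
    apply/mem_adj; exists (z * l), (z * a); split; first exact/KZ.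
    by ring.
  have /mem_adj[l' [c [Zl' ea]]] : ideal_adj Z z a.
    apply: Cx; apply/mem_adj; exists (- l), b; split; first exact: ideal_oppP.
    by rewrite [b * z]mulrC e; ring.
  apply/mem_adj; exists (b - c * x), c; split; last by rewrite subrK.
  apply/KZ; have -> : z * (b - c * x) = l + x * l' by rewrite mulrBr e ea; ring.
  by apply: ideal_addP => //; exact: ideal_mulP.
- exact: depth_ge_adj.
- exact: depth_ge_adj.
Qed.

End InfiniteResidueField.
End LocalRing.
(** * Heights, localization and chains of primes *)

Section PrimeChains.
Variable R : comPzRingType.
Implicit Types (p q : primeideal R).

Fixpoint chain_up p n : Prop :=
  if n is n'.+1 then exists2 q : primeideal R, p `<` q & chain_up q n' else True.

Fixpoint height_ge p n : Prop :=
  if n is n'.+1 then exists2 q : primeideal R, q `<` p & height_ge q n' else True.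

Definition height p n := height_ge p n /\ forall k, height_ge p k -> (k <= n)%N.

Lemma proper_sub_trans (A B C : set R) : A `<` B -> B `<=` C -> A `<` C.
Proof.
move=> [AB nBA] BC; split; first exact: subset_trans BC.
by move=> CA; apply: nBA; exact: subset_trans CA.
Qed.

Lemma sub_proper_trans (A B C : set R) : A `<=` B -> B `<` C -> A `<` C.
Proof.
move=> AB [BC nCB]; split; first exact: subset_trans BC.
by move=> CA; apply: nCB; exact: subset_trans AB.
Qed.

Lemma height_ge_sub p q n : p `<=` q -> height_ge p n -> height_ge q n.
Proof.
by case: n => // n pq [r rp hr]; exists r => //; exact: proper_sub_trans pq.
Qed.

Lemma chain_up_catl p a b : height_ge p a -> chain_up p b ->
  exists q, chain_up q (a + b).
Proof.
elim: a p b => [p b _|a IHa p b [q qp qa] pb]; first by exists p.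
by rewrite addSnnS; apply: IHa qa _; exists p.
Qed.

Lemma chain_up_fun p n : chain_up p n -> exists c : nat -> primeideal R,
  c 0 = p /\ forall i j, (i < j)%N -> (j <= n)%N -> c i `<` c j.
Proof.
elim: n p => [p _|n IHn p [q pq /IHn[c [c0 hc]]]].
  by exists (fun=> p); split=> // i j ij; rewrite leqn0 => /eqP j0; rewrite j0 in ij.
exists (fun i => if i is i'.+1 then c i' else p); split=> // -[|i] [|j]//=.
  case: j => [_ _|j _ jn]; first by rewrite c0.
  by apply: proper_sub_trans (properW (hc 0 j.+1 _ _)) => //; rewrite c0.
by rewrite !ltnS; exact: hc.
Qed.

Lemma height_ge_fun p n : height_ge p n -> exists c : nat -> primeideal R,
  c n = p /\ forall i j, (i < j)%N -> (j <= n)%N -> c i `<` c j.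
Proof.
elim: n p => [p _|n IHn p [q qp /IHn[c [cn hc]]]].
  by exists (fun=> p); split=> // i j ij; rewrite leqn0 => /eqP j0; rewrite j0 in ij.
exists (fun i => if (i <= n)%N then c i else p); split; first by rewrite ltnn.
move=> i j ij; rewrite leq_eqVlt => /orP[/eqP jn|].
  rewrite jn ltnn; rewrite jn ltnS in ij; rewrite ij.
  apply: sub_proper_trans qp; rewrite -cn; move: ij; rewrite leq_eqVlt.
  by move=> /orP[/eqP ->//|i_n]; apply: properW; exact: hc.
by rewrite ltnS => jn; rewrite (leq_trans (ltnW ij) jn) jn; exact: hc.
Qed.

Lemma has_prime_chain_up p n : chain_up p n -> has_prime_chain R n.
Proof.
move=> /chain_up_fun[c [_ hc]]; exists (fun i : 'I_n.+1 => c i) => i j ij.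
by apply: hc => //; rewrite -ltnS ltn_ord.
Qed.

Lemma height_chain_le d p a b : has_krull_dim R d -> height_ge p a ->
  chain_up p b -> (a + b <= d)%N.
Proof.
by move=> [_ hd] pa pb; have [q /has_prime_chain_up/hd] := chain_up_catl pa pb.
Qed.

Lemma height_exists d p : has_krull_dim R d -> exists n, height p n.
Proof.
move=> Rd; have ex0 : exists n, `[< height_ge p n >] by exists 0; apply/asboolP.
have ub n : `[< height_ge p n >] -> (n <= d)%N.
  by move=> /asboolP hn; rewrite -(addn0 n); exact: (@height_chain_le d p).
have [n /asboolP hn nmax] := ex_maxnP ex0 ub.
by exists n; split=> // k /asboolP; exact: nmax.
Qed.

Lemma height_lt p q n n' : p `<` q -> height p n -> height q n' -> (n < n')%N.
Proof. by move=> pq [hp _] [_ hq]; apply: hq; exists p. Qed.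

Lemma has_krull_dim_uniq d d' : has_krull_dim R d -> has_krull_dim R d' -> d = d'.
Proof.
by move=> [h hm] [h' hm']; apply/eqP; rewrite eqn_leq hm'// hm.
Qed.

Lemma has_prime_chain_height n (c : 'I_n.+1 -> primeideal R) :
  (forall i j : 'I_n.+1, (i < j)%N -> c i `<` c j) ->
  height_ge (c ord_max) n.
Proof.
move=> hc; suff h k (i : 'I_n.+1) : i = k :> nat -> height_ge (c i) k by exact: h.
elim: k i => // k IHk i ik.
have kn : (k < n.+1)%N by rewrite -[k.+1]ik ltnW// ltn_ord.
by exists (c (Ordinal kn)); [apply: hc; rewrite ik|exact: IHk].
Qed.

End PrimeChains.

Section Localization.
Variables (R : comPzRingType) (p : primeideal R).
Implicit Types (I L : ideal R) (u v : loc_frac p).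

Lemma loc_mkD u v : loc_mk u + loc_mk v = loc_mk (frac_add u v).
Proof. exact: loc_addE. Qed.

Lemma loc_mkM u v : loc_mk u * loc_mk v = loc_mk (frac_mul u v).
Proof. exact: loc_mulE. Qed.

Definition loc_inv (s : R) (ps : ~ p s) : loc p := loc_mk (mk_frac 1 ps).

Lemma loc_mk_proj u : loc_mk u = loc_proj p (val u).1 * loc_inv (@loc_denP _ _ u).
Proof. by rewrite loc_mkM; apply: loc_mk_eq => /=; ring. Qed.

Lemma loc_proj_mk u : loc_proj p (val u).1 = loc_proj p (val u).2 * loc_mk u.
Proof. by rewrite loc_mkM; apply: loc_mk_eq => /=; ring. Qed.

Lemma loc_projM a b : loc_proj p (a * b) = loc_proj p a * loc_proj p b.
Proof. by rewrite loc_mkM; apply: loc_mk_eq => /=; ring. Qed.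

Lemma loc_projD a b : loc_proj p (a + b) = loc_proj p a + loc_proj p b.
Proof. by rewrite loc_mkD; apply: loc_mk_eq => /=; ring. Qed.

Lemma loc_proj1 : loc_proj p 1 = 1. Proof. by []. Qed.
Lemma loc_proj0 : loc_proj p 0 = 0. Proof. by []. Qed.

Lemma loc_proj_inv s (ps : ~ p s) : loc_proj p s * loc_inv ps = 1.
Proof. by rewrite loc_mkM -loc_proj1; apply: loc_mk_eq => /=; ring. Qed.

(** The inclusion of I_p in L_p with one common denominator, which allows arguing inside R;
    [loc_subP] gives the equivalence over a Noetherian ring. *)
Definition loc_sub I L := exists2 s, ~ p s & forall x, I x -> L (s * x).

Lemma mem_loc_ideal I x :
  loc_ideal p I x <-> exists u : loc_frac p, I (val u).1 /\ x = loc_mk u.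
Proof.
split=> [|[u [Iu ->]]]; last first.
  rewrite loc_mk_proj; apply: ideal_mulPr; apply: sub_ideal_gen.
  by exists (val u).1.
have @K : ideal (loc p).
  exists [set x | exists u : loc_frac p, I (val u).1 /\ x = loc_mk u].
  - exists (mk_frac 0 (@loc_den1 _ p)); split=> //; exact: ideal_has0.
  - move=> _ _ [u [Iu ->]] [v [Iv ->]]; exists (frac_add u v).
    rewrite loc_mkD; split=> //=.
    by apply: ideal_addP; exact: ideal_mulPr.
  - elim/loc_ind => a _ [u [Iu ->]]; exists (frac_mul a u).
    by rewrite loc_mkM; split=> //=; exact: ideal_mulP.
move=> /(_ K); apply=> _ [a Ia <-].
by exists (mk_frac a (@loc_den1 _ p)).
Qed.

Lemma loc_ideal_proj I a :
  loc_ideal p I (loc_proj p a) <-> exists2 s, ~ p s & I (s * a).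
Proof.
rewrite mem_loc_ideal; split=> [[u [Iu /loc_mkP[t pt /= e]]]|[s ps Isa]].
  exists (t * (val u).2); first by apply: loc_denM => //; exact: loc_denP.
  by rewrite mulrAC -mulrA e mulr1; exact: ideal_mulP.
exists (mk_frac (s * a) ps); split=> //; apply: loc_mk_eq => /=; ring.
Qed.

Lemma loc_subP I L : noetherian R ->
  loc_ideal p I `<=` loc_ideal p L <-> loc_sub I L.
Proof.
move=> Rn; split=> [|[s ps h] x /mem_loc_ideal[u [Iu ->]]]; last first.
  rewrite loc_mk_proj; apply: ideal_mulPr; apply/loc_ideal_proj.
  by exists s => //; exact: h.
have [t -> h] := Rn I.
have {h} : forall x, x \in t -> exists2 s, ~ p s & L (s * x).
  move=> x /span_mem tx; apply/loc_ideal_proj/h.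
  by apply: sub_ideal_gen; exists x.
elim: t => [_|x t IHt h].
  exists 1; first exact: loc_den1.
  by move=> x /mem_span_nil ->; rewrite mulr0; exact: ideal_has0.
have [|s ps hs] := IHt; first by move=> y ty; apply: h; rewrite in_cons ty orbT.
have [s' ps' Ls'] := h x (mem_head _ _).
exists (s' * s); first exact: loc_denM.
move=> _ /mem_span_cons[a [b [tb ->]]].
have -> : s' * s * (a * x + b) = a * s * (s' * x) + s' * (s * b) by ring.
by apply: ideal_addP; apply: ideal_mulP => //; exact: hs.
Qed.

Lemma loc_sub_trans I J L : loc_sub I J -> loc_sub J L -> loc_sub I L.
Proof.
move=> [s ps hs] [t pt ht]; exists (t * s); first exact: loc_denM.
by move=> x Ix; rewrite -mulrA; apply/ht/hs.
Qed.

Lemma sub_loc_sub I L : I `<=` L -> loc_sub I L.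
Proof.
move=> IL; exists 1; first exact: loc_den1.
by move=> x Ix; rewrite mul1r; exact: IL.
Qed.

Lemma prime_contract (P : primeideal (loc p)) : exists q : primeideal R,
  q `<=` p /\ forall a, q a <-> P (loc_proj p a).
Proof.
have [P1 PM] := prime_idealP P.
have @q : ideal R.
  exists [set a | P (loc_proj p a)].
  - by rewrite /= loc_proj0; exact: ideal_has0.
  - by move=> x y Px Py; rewrite /= loc_projD; exact: ideal_addP.
  - by move=> a x Px; rewrite /= loc_projM; exact: ideal_mulP.
have qp : is_prime q.
  split=> [|x y]; first by rewrite /is_proper /= loc_proj1.
  by rewrite /= loc_projM => /PM.
exists (PrimeIdeal qp); split=> // a Pa; apply: contrapT => pa; apply: P1.
by rewrite -(loc_proj_inv pa); exact: ideal_mulPr.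
Qed.

Lemma prime_extend (q : primeideal R) : q `<=` p -> exists P : primeideal (loc p),
  forall a, q a <-> P (loc_proj p a).
Proof.
move=> qp; have [q1 qM] := prime_idealP q.
have projE a : q a <-> loc_ideal p q (loc_proj p a).
  rewrite loc_ideal_proj; split=> [qa|[s ps /qM[/qp//|//]]].
  by exists 1; [exact: loc_den1|rewrite mul1r].
have mkE u : loc_ideal p q (loc_mk u) <-> q (val u).1.
  rewrite projE; split=> [|h]; first by rewrite loc_proj_mk; exact: ideal_mulP.
  by rewrite loc_mk_proj; exact: ideal_mulPr.
have Pp : is_prime (loc_ideal p q).
  split=> [|]; first by rewrite /is_proper -loc_proj1 -projE.
  elim/loc_ind => u; elim/loc_ind => v; rewrite loc_mkM !mkE; exact: qM.
by exists (PrimeIdeal Pp).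
Qed.

Lemma prime_loc_sub (P Q : primeideal (loc p)) :
  (forall a, P (loc_proj p a) -> Q (loc_proj p a)) -> P `<=` Q.
Proof.
move=> h; elim/loc_ind => u; rewrite [in Q _]loc_mk_proj => Pu; apply: ideal_mulPr.
by apply: h; rewrite loc_proj_mk; exact: ideal_mulP.
Qed.

Lemma loc_prime_chain n : has_prime_chain (loc p) n <-> height_ge p n.
Proof.
split=> [[c hc]|/height_ge_fun[c [cn hc]]].
  pose f i := projT1 (cid (prime_contract (c i))).
  have fP i : f i `<=` p /\ forall a, f i a <-> c i (loc_proj p a).
    exact: projT2 (cid (prime_contract (c i))).
  apply: height_ge_sub (fP ord_max).1 _; apply: has_prime_chain_height => i j ij.
  have [ci nci] := hc i j ij; split=> [a /(fP _).2 /ci /(fP _).2//|h].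
  by apply: nci; apply: prime_loc_sub => a /(fP _).2/h/(fP _).2.
have cp (i : 'I_n.+1) : c i `<=` p.
  have := ltn_ord i; rewrite ltnS leq_eqVlt => /orP[/eqP ->|i_n]; first by rewrite cn.
  by rewrite -cn; apply: properW; exact: hc.
pose f (i : 'I_n.+1) := projT1 (cid (prime_extend (cp i))).
have fP (i : 'I_n.+1) : forall a, c i a <-> f i (loc_proj p a).
  exact: projT2 (cid (prime_extend (cp i))).
exists f => i j ij; have [|cij ncij] := hc i j ij; first by rewrite -ltnS ltn_ord.
split; first by apply: prime_loc_sub => a /fP/cij/fP.
by move=> h; apply: ncij => a /fP/h/fP.
Qed.

Lemma loc_krull_dim n : has_krull_dim (loc p) n <-> height p n.
Proof.
split=> -[/loc_prime_chain h hm]; split=> // k /loc_prime_chain; exact: hm.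
Qed.

End Localization.

Section QuotientPrimes.
Variables (R : comPzRingType) (K : ideal R).

Lemma quot_has_prime_chain (p : primeideal R) n : K `<=` p -> chain_up p n ->
  has_prime_chain (quot K) n.
Proof.
move=> Kp /chain_up_fun[c [c0 hc]].
have Kc (i : 'I_n.+1) : K `<=` c i.
  case: i => -[|i] /= i_n; first by rewrite c0.
  by apply: subset_trans Kp _; rewrite -c0; apply: properW; exact: hc.
have imP (q : primeideal R) : K `<=` q -> exists Q : primeideal (quot K),
    forall a, Q (quot_proj K a) <-> q a.
  move=> Kq; have [q1 qM] := prime_idealP q.
  have @Q : ideal (quot K).
    exists [set x | exists a, x = quot_proj K a /\ q a].
    - by exists 0; rewrite rmorph0; split=> //; exact: ideal_has0.
    - move=> _ _ [a [-> qa]] [b [-> qb]]; exists (a + b).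
      by rewrite rmorphD; split=> //; exact: ideal_addP.
    - elim/quot_ind => c' _ [a [-> qa]]; exists (c' * a).
      by rewrite rmorphM; split=> //; exact: ideal_mulP.
  have QE a : Q (quot_proj K a) <-> q a.
    split=> [[b [/quot_projP Kab qb]]|qa]; last by exists a.
    by rewrite -(subrK b a); apply: ideal_addP => //; exact: Kq.
  have Qp : is_prime Q.
    split; first by rewrite /is_proper -(rmorph1 (quot_proj K)) QE.
    by elim/quot_ind => x; elim/quot_ind => z; rewrite -rmorphM !QE; exact: qM.
  by exists (PrimeIdeal Qp).
pose f (i : 'I_n.+1) := projT1 (cid (imP _ (Kc i))).
have fP (i : 'I_n.+1) : forall a, f i (quot_proj K a) <-> c i a.
  exact: projT2 (cid (imP _ (Kc i))).
exists f => i j ij; have [|cij ncij] := hc i j ij; first by rewrite -ltnS ltn_ord.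
split; first by elim/quot_ind => a /fP/cij/fP.
by move=> h; apply: ncij => a /fP/h/fP.
Qed.

Lemma quot_span (s : seq R) b :
  ideal_span (map (quot_proj K) s) (quot_proj K b) <-> (K + ideal_span s)%ideal b.
Proof.
split; last first.
  move=> /mem_ideal_add[k [z [Kk sz ->]]].
  have -> : quot_proj K (k + z) = quot_proj K z by apply/quot_projP; rewrite addrK.
  move: sz => /mem_span[c ->]; rewrite rmorph_sum.
  apply: ideal_sumP => i _; rewrite rmorphM; apply: ideal_mulP.
  by apply: span_mem; apply: map_f; rewrite mem_nth.
have @J : ideal (quot K).
  exists [set x | exists a, x = quot_proj K a /\ (K + ideal_span s)%ideal a].
  - by exists 0; rewrite rmorph0; split=> //; exact: ideal_has0.
  - move=> _ _ [a [-> sa]] [a' [-> sa']]; exists (a + a').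
    by rewrite rmorphD; split=> //; exact: ideal_addP.
  - elim/quot_ind => c _ [a [-> sa]]; exists (c * a).
    by rewrite rmorphM; split=> //; exact: ideal_mulP.
have sJ : ideal_span (map (quot_proj K) s) `<=` J.
  apply: span_min => _ /mapP[x xs ->]; exists x; split=> //.
  by apply: ideal_add_subr; exact: span_mem.
move=> /sJ[a [/quot_projP Kba sa]].
by rewrite -(subrK a b); apply: ideal_addP => //; exact: ideal_add_subl.
Qed.

End QuotientPrimes.
(** * Depth, associated primes and systems of parameters *)

Section DepthAndChains.
Variables (R : comPzRingType) (m : maxideal R).
Hypotheses (R_noetherian : noetherian R) (R_local : local_ring m).
Implicit Types (I J K L : ideal R) (p q : primeideal R).

(* A regular [x] lies outside [p], and reducing modulo [x] leads to an
   associated prime containing [p + (x)]: by Nakayama the elements killed by [p]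
   in [R/L] are not all multiples of [x]. *)
Lemma depth_ge_chain n L p u : depth_ge m n L -> associated_at L p u ->
  chain_up p n.
Proof.
elim: n L p u => // n IHn L p u [x [mx Lx dx]] pu.
have px : ~ p x by move=> /pu/Lx; exact: associated_notin pu.
pose N := ideal_colon L p.
have [v Nv xv] : exists2 v, N v & ~ ideal_adj L x v.
  apply: contrapT => h; apply: (associated_notin pu).
  apply: (nakayama R_noetherian R_local (I := N)); last first.
    by move=> b pb; rewrite mulrC; exact/pu.
  move=> v Nv; have /mem_adj[l [a [Ll e]]] : ideal_adj L x v.
    by apply: contrapT => xv; apply: h; exists v.
  rewrite e; apply: ideal_addP; first exact: ideal_add_subl.
  apply: ideal_add_subr; rewrite mulrC; apply: ideal_mul_mem => // b pb.
  apply: Lx; have -> : x * (a * b) = v * b - l * b by rewrite e; ring.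
  by apply: ideal_subP; [exact: Nv|exact: ideal_mulPr].
have [q [r qr]] := associated_exists R_noetherian xv.
exists q; last exact: IHn dx qr.
split=> [b pb|/(_ x) h]; last first.
  apply: px; apply: h; apply/qr; rewrite mulrC; exact: adj_mem.
apply/qr; apply: adj_sub; rewrite mulrCA; apply: ideal_mulP.
by rewrite mulrC; exact: Nv.
Qed.

Lemma depth_ge_seq L (s : seq R) : is_proper (L + ideal_span s)%ideal ->
  (forall i, (i < size s)%N ->
     regular_mod (L + ideal_span (take i s))%ideal s`_i) ->
  depth_ge m (size s) L.
Proof.
move=> Ls hs.
suff h k : (k <= size s)%N -> depth_ge m k (L + ideal_span (take (size s - k) s))%ideal.
  have := h _ (leqnn _); rewrite subnn take0.
  have -> // : (L + ideal_span [::])%ideal = L.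
  apply: ideal_eqP => z; split; move: z; last exact: ideal_add_subl.
  by apply: ideal_add_min => // z /mem_span_nil ->; exact: ideal_has0.
elim: k => // k IHk ks; set i := (size s - k.+1)%N.
have i_s : (i < size s)%N by rewrite ltn_subrL /=; exact: leq_trans ks.
exists s`_i; split; [|exact: hs|].
  apply: (local_proper R_noetherian R_local Ls); apply: ideal_add_subr.
  by apply: span_mem; rewrite mem_nth.
have := IHk (ltnW ks); rewrite (_ : size s - k = i.+1)%N; last by rewrite /i subnSK.
rewrite (take_nth 0)// span_rcons; set A := ideal_adj _ _.
have -> // : (L + A)%ideal = ideal_adj (L + ideal_span (take i s)) s`_i.
apply: ideal_eqP => z; split; move: z.
  apply: ideal_add_min; last apply: adj_min; last exact: adj_id.
    by apply: subset_trans (@adj_sub _ _ _); exact: ideal_add_subl.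
  by apply: subset_trans (@adj_sub _ _ _); exact: ideal_add_subr.
apply: adj_min; last by apply: ideal_add_subr; exact: adj_id.
apply: ideal_add_min; first exact: ideal_add_subl.
by apply: subset_trans (@ideal_add_subr _ _ _); exact: adj_sub.
Qed.

Lemma depth_ge_has_depth n : has_depth R n -> depth_ge m n (ideal_span [::]).
Proof.
have e s : (ideal_span [::] + ideal_span s)%ideal = ideal_span s :> ideal R.
  by rewrite -span_cat.
move=> [[s [s1 hs] <-] _]; apply: depth_ge_seq; first by rewrite e.
by move=> i si b; rewrite e; exact: hs.
Qed.

Lemma depth_ge_quot K n : has_depth (quot K) n -> depth_ge m n K.
Proof.
move=> [[s [s1 hs] <-] _].
have eqs : s = map (quot_proj K) (map repr s).
  by rewrite -map_comp -[LHS]map_id; apply: eq_map => x; rewrite /= quot_repr.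
set t := map repr s in eqs; have st : size s = size t by rewrite size_map.
rewrite st; apply: depth_ge_seq; first by move=> /quot_span; rewrite rmorph1 -eqs.
move=> i it b /quot_span; rewrite map_take -eqs rmorphM /= => h.
apply/quot_span; rewrite map_take -eqs; apply: hs; first by rewrite st.
by rewrite [s in s`_i]eqs (nth_map 0).
Qed.

(** Depth equals dimension, and the chain above p bounds dim R/K from below. For K = R the depth is
    infinite by convention, so no chain is asked for. *)
Lemma cohen_macaulay_depth_ge K n : cohen_macaulay (quot K) ->
  (is_proper K -> exists2 p : primeideal R, K `<=` p & chain_up p n) ->
  depth_ge m n K.
Proof.
move=> KCM h; have [K1|nK1] := pselect (K 1).
  have -> : K = ideal_one R; last exact: depth_ge_one.
  by apply: ideal_eqP => z; split=> // _; rewrite -[z]mulr1; exact: ideal_mulP.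
case: KCM => [e|[n' [[_ dimK] dK]]].
  case: nK1; move: e; rewrite -(rmorph1 (quot_proj K)) -(rmorph0 (quot_proj K)).
  by move=> /quot_projP; rewrite subr0.
have [p Kp /(quot_has_prime_chain Kp)/dimK nn'] := h nK1.
exact: depth_ge_le (depth_ge_quot dK).
Qed.

(* Regular sequences, without the properness requirement. *)
Fixpoint regular_list L (s : seq R) : Prop :=
  if s is x :: s' then regular_mod L x /\ regular_list (ideal_adj L x) s' else True.

(** A regular sequence x, s may be rotated to s, x. For the head w of s, the ideal N = L : w
    satisfies N <= L + x N because w is regular modulo L + (x) and x modulo L; Nakayama then gives N
    <= L. *)
Lemma regular_list_rotate L x s : m x -> regular_mod L x ->
  regular_list (ideal_adj L x) s ->
  regular_list L s /\ regular_mod (L + ideal_span s)%ideal x.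
Proof.
elim: s L => [|w s IHs] L mx Lx.
  by have -> : (L + ideal_span [::])%ideal = L by
    apply: ideal_eqP => z; split; move: z; [apply: ideal_add_min => // z /mem_span_nil ->;
      exact: ideal_has0|exact: ideal_add_subl].
move=> [Lw]; rewrite adjC => hs.
have [Lws Lwx] := IHs _ mx (regular_swap Lx Lw) hs.
rewrite add_span_cons; split=> //; split=> // b Lwb.
pose N := ideal_colon L (ideal_span [:: w]).
have NE c : N c <-> L (w * c).
  split=> [/(_ w (span_mem (mem_head _ _)))|Lwc z /mem_span1[a ->]].
    by rewrite mulrC.
  by rewrite mulrCA mulrC; apply: ideal_mulPr; rewrite mulrC.
apply: (nakayama R_noetherian R_local (I := N)); last exact/NE.
move=> c /NE Lwc; have /mem_adj[l [a [Ll e]]] : ideal_adj L x c.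
  by apply: Lw; exact: adj_sub.
rewrite e; apply: ideal_addP; first exact: ideal_add_subl.
apply: ideal_add_subr; rewrite mulrC; apply: ideal_mul_mem => //; apply/NE.
apply: Lx; have -> : x * (w * a) = w * c - w * l by rewrite e; ring.
by apply: ideal_subP => //; exact: ideal_mulP.
Qed.

Hypothesis k_infinite : infinite_set [set: residue_field m].

Lemma adj_span_congr L s x y : ideal_span s (y - x) ->
  ideal_adj (L + ideal_span s) x = ideal_adj (L + ideal_span s) y.
Proof.
move=> sxy; apply: ideal_eqP => z; split; move: z; apply: adj_min;
  try exact: adj_sub.
  have -> : x = y - (y - x) by ring.
  apply: ideal_subP; first exact: adj_id.
  by apply: adj_sub; exact: ideal_add_subr.
rewrite -(subrK x y); apply: ideal_addP; last exact: adj_id.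
by apply: adj_sub; exact: ideal_add_subr.
Qed.

(* A system of [depth R/L] parameters on [R/L] is a regular sequence: the last
   parameter can be replaced by a regular element in its coset modulo the
   others, which is then moved to the front. *)
Lemma parameters_regular L s : depth_ge m (size s) L ->
  (forall x, x \in s -> m x) ->
  (forall p, (L + ideal_span s)%ideal `<=` p -> m `<=` p) ->
  regular_list L s.
Proof.
move: {2}(size s) (erefl (size s)) => n; elim: n s L => [|n IHn] s L.
  by move=> /size0nil ->.
case/lastP: s => // s x; rewrite size_rcons => -[sn]; rewrite sn => dL ms prim.
have [S hS] := associated_finite R_noetherian L.
pose S' := List.filter
  (fun Q : ideal R => `[< exists (p : primeideal R) u,
     Q = p :> ideal R /\ associated_at L p u >]) S.
have [y ys hy] := avoid_coset R_noetherian R_local k_infinite S' x s.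
have mss z : z \in s -> m z by move=> zs; apply: ms; rewrite mem_rcons in_cons zs orbT.
have my : m y.
  rewrite -(subrK x y); apply: ideal_addP; first exact: span_min mss _ ys.
  by apply: ms; rewrite mem_rcons mem_head.
have Ly : regular_mod L y.
  move=> b Lyb; apply: contrapT => Lb.
  have [p [r [py pr]]] := associated_of_zerodiv R_noetherian Lyb Lb.
  have [|px ps] := hy p _ py.
    apply/List.filter_In; split; first exact: hS pr.
    by apply/asboolP; exists p, (r * b).
  have mp : m `<=` p.
    apply: prim; apply: ideal_add_min; first exact: associated_sub pr.
    by apply: span_min => z; rewrite mem_rcons in_cons => /predU1P[->//|/ps].
  have [z [mz Lz _]] := dL; apply: (associated_notin pr); apply: Lz.
  exact/pr/mp.
have [|Ls Lsy] := @regular_list_rotate L y s my Ly.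
  apply: IHn => //.
    by rewrite sn; exact: (depth_ge_adj R_noetherian R_local k_infinite).
  move=> p; rewrite -adj_add_span => hp; apply: prim => z.
  rewrite -cats1 span_cat => hz; apply: hp; move: z hz.
  rewrite -(adj_span_congr _ ys); apply: ideal_add_min.
    by apply: subset_trans (@adj_sub _ _ _); exact: ideal_add_subl.
  apply: ideal_add_min; last exact: ideal_add_subr.
  by apply: subset_trans (@adj_sub _ _ _); exact: ideal_add_subr.
have Lsx : regular_mod (L + ideal_span s)%ideal x.
  move=> b Lxb; apply: Lsy; rewrite -(subrK x y) mulrDl.
  apply: ideal_addP => //; apply: ideal_mulPr; exact: ideal_add_subr.
elim: (s) L Ls Lsx {IHn prim ms ys hy mss Lsy sn dL S hS S' my Ly} => [|w t IHt] L.
  move=> _ h; split=> // b Lb.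
  have /mem_ideal_add[l [z [Ll /mem_span_nil -> ->]]] := h b (@ideal_add_subl _ _ _ _ Lb).
  by rewrite addr0.
move=> [Lw Lt]; rewrite add_span_cons => h; split=> //; exact: IHt.
Qed.

End DepthAndChains.
(** * General residual intersections *)

Section GeneralResidualIntersections.
Variables (R : comPzRingType) (m : maxideal R) (d : nat) (I : ideal R).
Hypotheses (R_noetherian : noetherian R) (R_local : local_ring m).
Hypothesis k_infinite : infinite_set [set: residue_field m].
Hypothesis R_dim : has_krull_dim R d.
Implicit Types (p q : primeideal R) (Z L : ideal R).

(* [(I/Z)_p] is generated by [j] elements. *)
Definition gens_at p Z j := exists g : seq R,
  [/\ (size g <= j)%N, forall x, x \in g -> I x &
      loc_sub p I (Z + ideal_span g)%ideal].

Lemma gens_at_le p Z j j' : (j <= j')%N -> gens_at p Z j -> gens_at p Z j'.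
Proof. by move=> jj' [g [gj gI h]]; exists g; split=> //; exact: leq_trans jj'. Qed.

Lemma gens_at_sub p Z Z' j : Z `<=` Z' -> gens_at p Z j -> gens_at p Z' j.
Proof.
move=> ZZ' [g [gj gI h]]; exists g; split=> //.
apply: loc_sub_trans h _; apply: sub_loc_sub; apply: ideal_add_min.
  by apply: subset_trans ZZ' _; exact: ideal_add_subl.
exact: ideal_add_subr.
Qed.

Lemma gens_at0 p Z : gens_at p Z 0 -> loc_sub p I Z.
Proof.
move=> [g [+ _ h]]; rewrite leqn0 => /eqP/size0nil g0.
apply: loc_sub_trans h _; apply: sub_loc_sub; rewrite g0.
by apply: ideal_add_min => // z /mem_span_nil ->; exact: ideal_has0.
Qed.

(* The preimage in [R] of [(Z + p I)_p]. *)
Definition nongens (P Z : ideal R) : ideal R :=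
  ideal_gen [set r | exists2 s, ~ P s & (Z + P * I)%ideal (s * r)].

Lemma mem_nongens p Z r :
  nongens p Z r <-> exists2 s, ~ p s & (Z + p * I)%ideal (s * r).
Proof.
split=> [|h]; last exact: sub_ideal_gen.
have @K : ideal R.
  exists [set r | exists2 s, ~ p s & (Z + p * I)%ideal (s * r)].
  - exists 1; first exact: loc_den1.
    by rewrite mulr0; exact: ideal_has0.
  - move=> x y [s ps hs] [t pt ht]; exists (s * t); first exact: loc_denM.
    have -> : s * t * (x + y) = t * (s * x) + s * (t * y) by ring.
    by apply: ideal_addP; exact: ideal_mulP.
  - move=> a x [s ps hs]; exists s => //.
    by rewrite mulrCA; exact: ideal_mulP.
by move=> /(_ K); exact.
Qed.

Lemma mem_add_span_cons Z x s z : (Z + ideal_span (x :: s))%ideal z <->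
  exists a b, (Z + ideal_span s)%ideal b /\ z = a * x + b.
Proof.
rewrite add_span_cons -adj_add_span mem_adj.
by split=> -[l [a [? ->]]]; exists a, l; rewrite addrC.
Qed.

(** Locally at p the element z is a minimal generator of I/Z, so it replaces some g_i, namely one
    whose coefficient in an expression of a multiple of z lies outside p. *)
Lemma gens_at_drop p Z j z : gens_at p Z j.+1 -> I z -> ~ nongens p Z z ->
  gens_at p (ideal_adj Z z) j.
Proof.
move=> [g [gj gI [s ps hs]]] Iz /mem_nongens nz.
have [gj'|gj'] := leqP (size g) j.
  by apply: (gens_at_sub (@adj_sub _ Z z)); exists g; split=> //; exists s.
have /mem_ideal_add[l [t [Zl /mem_span[c tE] e]]] := hs z Iz.
have [i /asboolPn pci] : exists i : 'I_(size g), ~~ `[< p (c i) >].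
  apply: contrapT => h; apply: nz; exists s => //; rewrite e.
  apply: ideal_addP; first exact: ideal_add_subl.
  apply: ideal_add_subr; rewrite tE; apply: ideal_sumP => i _.
  apply: ideal_mul_mem; last by apply: gI; rewrite mem_nth.
  by apply: contrapT => pci; apply: h; exists i; apply/asboolPn.
exists (delete_nth g i); split.
- by rewrite -ltnS size_delete_nth.
- by move=> x /mem_delete_nth/gI.
apply: (loc_sub_trans (J := (Z + ideal_span g)%ideal)); first by exists s.
exists (c i) => //.
set N := (ideal_adj Z z + ideal_span (delete_nth g i))%ideal.
have ZN : Z `<=` N by apply: subset_trans (@ideal_add_subl _ _ _); exact: adj_sub.
have g'N k : (k < size g)%N -> k != i -> N g`_k.
  by move=> kg ki; apply: ideal_add_subr; apply: span_mem; exact: nth_in_delete_nth.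
have giN : N (c i * g`_i).
  have -> : c i * g`_i = s * z - l - \sum_(k < size g | k != i) c k * g`_k.
    by rewrite e tE (bigD1 i)//=; ring.
  apply: ideal_subP; first apply: ideal_subP; last 2 first.
  - exact: ZN.
  - by apply: ideal_sumP => k ki; apply: ideal_mulP; exact: g'N.
  - by apply: ideal_add_subl; exact: adj_mem.
move=> x /mem_ideal_add[l' [t' [Zl' /mem_span[c' ->] ->]]].
rewrite mulrDr; apply: ideal_addP; first by apply: ideal_mulP; exact: ZN.
rewrite mulr_sumr; apply: ideal_sumP => k _; rewrite mulrCA; apply: ideal_mulP.
have [->//|ki] := eqVneq k i.
by apply: ideal_mulP; exact: g'N.
Qed.

(** Nakayama at p, carried out for the first generator only: it satisfies a relation modulo Z and
    the other generators with coefficient s t - c_0, where s t is outside p and c_0 in p. *)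
Lemma gens_at_nakayama p Z j : gens_at p Z j.+1 -> I `<=` nongens p Z ->
  gens_at p Z j.
Proof.
move=> [[|g0 g] [gj gI [s ps hs]]] IQ.
  by exists [::]; split=> //; exists s.
have /IQ/mem_nongens[t pt /mem_ideal_add[l [w [Zl pw e]]]] := gI g0 (mem_head _ _).
have : (Z + p * ideal_span (g0 :: g))%ideal (s * w).
  pose N := ideal_colon (Z + p * ideal_span (g0 :: g))%ideal (ideal_span [:: s]).
  have NE r : N r <-> (Z + p * ideal_span (g0 :: g))%ideal (s * r).
    split=> [/(_ s (span_mem (mem_head _ _)))|h b /mem_span1[a ->]].
      by rewrite mulrC.
    by rewrite mulrCA [r * s]mulrC; exact: ideal_mulP.
  apply/NE; move: w pw {e}; apply: ideal_mul_min => a b pa Ib; apply/NE.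
  have /mem_ideal_add[l' [b' [Zl' gb' eb]]] := hs b Ib.
  rewrite mulrCA eb mulrDr; apply: ideal_addP.
    by apply: ideal_add_subl; exact: ideal_mulP.
  by apply: ideal_add_subr; exact: ideal_mul_mem.
rewrite ideal_mulC => /mem_ideal_add[l' [w' [Zl' /mem_span_mul[c [pc ew']] ew]]].
have {}ew' : w' = c 0 * g0 + \sum_(i < size g) c i.+1 * g`_i.
  by rewrite ew' big_ord_recl.
have pst : ~ p (s * t - c 0).
  move=> h; have : p (s * t) by rewrite -(subrK (c 0) (s * t)); exact: ideal_addP.
  by move=> /primeM[].
exists g; split=> //; first by move=> x xg; apply: gI; rewrite in_cons xg orbT.
apply: (loc_sub_trans (J := (Z + ideal_span (g0 :: g))%ideal)); first by exists s.
exists (s * t - c 0) => // x /mem_add_span_cons[a [b [hb ->]]].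
have -> : (s * t - c 0) * (a * g0 + b)
    = a * (s * (t * g0) - c 0 * g0) + (s * t - c 0) * b by ring.
apply: ideal_addP; apply: ideal_mulP => //.
rewrite e mulrDr ew ew'.
set u := \sum_(i < _) _.
have -> : s * l + (l' + (c 0 * g0 + u)) - c 0 * g0 = (s * l + l') + u by ring.
apply: ideal_addP.
  by apply: ideal_add_subl; apply: ideal_addP => //; exact: ideal_mulP.
apply: ideal_add_subr; apply: ideal_sumP => k _; apply: ideal_mulP.
by apply: span_mem; rewrite mem_nth.
Qed.

(* Its zero locus consists of the primes [p] containing [I] at which [(I/Z)_p]
   is not generated by [j] elements. *)
Definition fitting_locus Z j : ideal R := ideal_gen (I `|`
  [set c | exists g : seq R, [/\ (size g <= j)%N, forall x, x \in g -> I x &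
     forall x, I x -> (Z + ideal_span g)%ideal (c * x)]]).

Lemma fitting_locusP Z j p :
  fitting_locus Z j `<=` p <-> I `<=` p /\ ~ gens_at p Z j.
Proof.
split=> [h|[Ip ng]].
  split=> [x Ix|[g [gj gI [s ps hs]]]]; first by apply: h; apply: sub_ideal_gen; left.
  by apply: ps; apply: h; apply: sub_ideal_gen; right; exists g.
apply: ideal_gen_min => x [/Ip//|[g [gj gI hx]]].
by apply: contrapT => px; apply: ng; exists g; split=> //; exists x.
Qed.

(** For Z = 0 and i = 0 this is G_d. The subtraction is truncated, so at heights h <= i it says I_p
    = Z_p, which is the geometric condition. *)
Definition gens_bound Z i := forall p h, I `<=` p -> height p h -> (h < d)%N ->
  gens_at p Z (h - i).

(** The residual intersection condition outside V(I), where I_p is the unit ideal. *)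
Definition avoids_low Z i := forall p h, ~ (I `<=` p) -> height p h -> (h < i)%N ->
  ~ (Z `<=` p).

(** Two kinds of primes constrain z. Where (I/Z)_p really needs h - i generators, z has to be one of
    them; by the bound at smaller heights such p is minimal over a Fitting locus. And z must avoid
    the primes of height i containing Z but not I, which are minimal over Z. Both families are
    finite, and Z + (x, ws), which is H_(d-1) in the application, is locally large enough for a
    general member of the coset to satisfy all constraints. *)
Lemma residual_step Z i x (ws : seq R) : (i.+1 < d)%N ->
  Z `<=` I -> I x -> (forall w, w \in ws -> I w) ->
  gens_bound Z i -> avoids_low Z i ->
  (forall p h, height p h -> (h < d.-1)%N -> ~ (I `<=` p) ->
     ~ (ideal_adj (Z + ideal_span ws) x `<=` p)) ->
  (forall p h, I `<=` p -> height p h -> (h < d)%N ->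
     loc_sub p I (ideal_adj (Z + ideal_span ws) x)) ->
  exists z, [/\ ideal_span ws (z - x), I z,
    gens_bound (ideal_adj Z z) i.+1 & avoids_low (ideal_adj Z z) i.+1].
Proof.
move=> id ZI Ix wsI Zb Zl Yl Yb.
have [S hS] : exists S : seq (ideal R), forall j p, (j < d)%N ->
    fitting_locus Z j `<=` p ->
    (forall q, fitting_locus Z j `<=` q -> q `<=` p -> p `<=` q) ->
    List.In (p : ideal R) S.
  elim: (d) => [|n [S hS]]; first by exists [::].
  have [T hT] := minimal_primes_finite R_noetherian (fitting_locus Z n).
  exists (T ++ S)%SEQ => j p; rewrite ltnS leq_eqVlt => /orP[/eqP ->|jn] h1 h2;
    apply/List.in_or_app; [left; exact: hT|right; exact: hS jn h1 h2].
have [T hT] := minimal_primes_finite R_noetherian Z.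
have [z zws hz] := avoid_coset R_noetherian R_local k_infinite
  (List.map (fun P => nongens P Z) S ++ T)%SEQ x ws.
have Iz : I z by rewrite -(subrK x z); apply: ideal_addP => //; exact: span_min wsI _ zws.
exists z; split=> // p h Ip ph hi.
- have [hi'|hi'] := leqP h i.
    have e0 : (h - i = 0)%N by apply/eqP; rewrite subn_eq0.
    have -> : (h - i.+1 = h - i)%N by rewrite e0; apply/eqP; rewrite subn_eq0 leqW.
    by apply: (gens_at_sub (@adj_sub _ Z z)); exact: Zb ph hi.
  have hij : (h - i = (h - i.+1).+1)%N by rewrite subnSK.
  have := Zb p h Ip ph hi; rewrite hij; set j := (h - i.+1)%N => gj.
  have [gj'|gj'] := pselect (gens_at p Z j); first exact: gens_at_sub (@adj_sub _ Z z) gj'.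
  apply: gens_at_drop => // nz.
  have pS : List.In (p : ideal R) S.
    apply: (hS j); first exact: leq_ltn_trans (leq_subr _ _) hi.
      exact/fitting_locusP.
    move=> q /fitting_locusP[Iq ngq] qp; apply: contrapT => npq.
    have [h' qh'] := height_exists q R_dim.
    have h'h : (h' < h)%N by exact: (@height_lt _ q p).
    apply: ngq; apply: gens_at_le (Zb q h' Iq qh' (ltn_trans h'h hi)).
    by rewrite /j -ltnS -hij ltn_sub2r.
  have [|Qx Qws] := hz (nongens p Z) _ nz.
    by apply/List.in_or_app; left; exact: (List.in_map (fun P : ideal R => nongens P Z)).
  (* If the whole coset failed at p, then [nongens] would contain Z + (x, ws), hence I because both
     agree at p, contradicting the number of generators needed. *)
  apply: gj'; apply: gens_at_nakayama => // b Ib.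
  have [s ps hs] := Yb p h Ip ph hi.
  have Qs : nongens p Z (s * b).
    move: (s * b) (hs b Ib); apply: adj_min => //; apply: ideal_add_min; last exact: span_min.
    move=> l Zl'; apply/mem_nongens; exists 1; first exact: loc_den1.
    by rewrite mul1r; exact: ideal_add_subl.
  have /mem_nongens[t pt ht] := Qs.
  by apply/mem_nongens; exists (t * s); [exact: loc_denM|rewrite -mulrA].
- move=> Zzp; have Zp : Z `<=` p by apply: subset_trans Zzp; exact: adj_sub.
  move: hi; rewrite ltnS leq_eqVlt => /orP[/eqP hi|]; last by move=> /(Zl p h Ip ph).
  have pT : List.In (p : ideal R) T.
    apply: hT => // q Zq qp; apply: contrapT => npq.
    have [h' qh'] := height_exists q R_dim.
    have h'h : (h' < h)%N by exact: (@height_lt _ q p).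
    apply: (Zl q h' _ qh') => //; last by rewrite -hi.
    by move=> Iq; apply: Ip; exact: subset_trans qp.
  have [|px pws] := hz p _ (Zzp _ (@adj_id _ _ _)).
    by apply/List.in_or_app; right.
  apply: (Yl p h ph) => //; first by rewrite hi -ltnS prednK// (leq_trans _ id).
  by apply: adj_min => //; apply: ideal_add_min => //; exact: span_min.
Qed.

(** A triangular change of generators: each new z differs from the next y by a combination of the
    later ones, so the span of zs and the remaining ys never changes and its local properties are
    available at every step. *)
Lemma residual_generators (ys : seq R) : size ys = d.-1 ->
  (forall y, y \in ys -> I y) ->
  gens_bound (ideal_span [::]) 0 ->
  (forall p h, height p h -> (h < d.-1)%N -> loc_sub p I (ideal_span ys)) ->
  (forall p h, I `<=` p -> height p h -> (h < d)%N -> loc_sub p I (ideal_span ys)) ->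
  exists zs : seq R, [/\ size zs = size ys, ideal_span zs = ideal_span ys &
    forall i, (i <= size zs)%N -> gens_bound (ideal_span (take i zs)) i /\
      avoids_low (ideal_span (take i zs)) i].
Proof.
move=> sys Iys G0 Yl Yb.
suff h k : (k <= size ys)%N -> exists zs : seq R, [/\ size zs = k,
    ideal_span (zs ++ drop k ys)%SEQ = ideal_span ys &
    forall i, (i <= k)%N -> gens_bound (ideal_span (take i zs)) i /\
      avoids_low (ideal_span (take i zs)) i].
  have [zs [szs]] := h _ (leqnn _); rewrite drop_size cats0 => ezs hzs.
  by exists zs; split=> //; rewrite szs.
elim: k => [_|k IHk ks].
  exists [::]; rewrite drop0; split=> // i; rewrite leqn0 => /eqP ->; split=> //.
have [zs [szs ezs hzs]] := IHk (ltnW ks).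
pose Z := ideal_span zs; pose ws := drop k.+1 ys.
have [Zb Zl] : gens_bound Z k /\ avoids_low Z k.
  by have := hzs k (leqnn _); rewrite -szs take_size.
have eY z : ideal_span ws (z - ys`_k) ->
    ideal_adj (Z + ideal_span ws) z = ideal_span ys.
  move=> /(adj_span_congr Z) <-; rewrite adj_add_span -add_span_cons -span_cat.
  by rewrite /ws -drop_nth.
have ZI : Z `<=` I.
  apply: subset_trans (span_min Iys); rewrite -ezs span_cat; exact: ideal_add_subl.
have [|||||z [zws Iz zb zl]] := @residual_step Z k ys`_k ws _ ZI _ _ Zb Zl.
- by move: ks; rewrite sys; case: (d).
- by apply: Iys; rewrite mem_nth.
- by move=> w /mem_drop/Iys.
- rewrite eY ?subrr; last exact: ideal_has0.
  move=> p h ph hd nIp Yp; apply: nIp => b Ib.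
  have [s ps /(_ b Ib)/Yp] := Yl p h ph hd; by case/primeM.
- by rewrite eY ?subrr; [exact: Yb|exact: ideal_has0].
exists (rcons zs z); split.
- by rewrite size_rcons szs.
- by rewrite cat_rcons span_cat -/Z add_span_cons -adj_add_span eY.
- move=> i; rewrite leq_eqVlt => /orP[/eqP ->|].
    by rewrite -szs -[X in take X](size_rcons zs z) take_size span_rcons szs.
  rewrite ltnS => ik; have := hzs i ik; rewrite -cats1 takel_cat// szs//.
Qed.

End GeneralResidualIntersections.
(** * Residual intersections with Cohen-Macaulay quotients *)

Section ResidualDepth.
Variables (R : comPzRingType) (m : maxideal R) (d : nat) (I : ideal R) (zs : seq R).
Hypotheses (R_noetherian : noetherian R) (R_local : local_ring m).
Hypothesis k_infinite : infinite_set [set: residue_field m].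
Hypothesis R_dim : has_krull_dim R d.
Hypothesis d_gt0 : (0 < d)%N.
Hypothesis R_depth : depth_ge m d (ideal_span [::]).
Hypothesis zsI : forall z, z \in zs -> I z.
Hypothesis zs_size : size zs = d.-1.
Implicit Types (p q : primeideal R).

Let Z i := ideal_span (take i zs).
Let K i := ideal_colon (Z i) I.

Hypothesis residual : forall i p h, (i < d)%N -> height p h -> (h < i)%N ->
  loc_sub p I (Z i).
Hypothesis geometric : forall i p h, (i < d)%N -> I `<=` p -> height p h ->
  (h <= i)%N -> loc_sub p I (Z i).
Hypothesis residual_CM : forall i, (i.+1 < d)%N -> cohen_macaulay (quot (K i)).

Let ZI i : Z i `<=` I.
Proof. by apply: span_min => z /mem_take/zsI. Qed.

Let ZS i : (i.+1 < d)%N -> Z i.+1 = ideal_adj (Z i) zs`_i.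
Proof.
move=> id; rewrite /Z (take_nth 0) ?span_rcons// zs_size.
by case: (d) id.
Qed.

Let I_nth i : (i.+1 < d)%N -> I zs`_i.
Proof. by move=> id; apply: zsI; rewrite mem_nth// zs_size; case: (d) id. Qed.

(** Unmixedness: there is a chain of length d - i above p, and d bounds the height of p plus the
    length of any such chain. *)
Let associated_height i p u h : (i <= d)%N -> depth_ge m (d - i) (Z i) ->
  associated_at (Z i) p u -> height p h -> (h <= i)%N.
Proof.
move=> id dZ pu [ph _]; have pd := depth_ge_chain R_noetherian R_local dZ pu.
by have := height_chain_le R_dim ph pd; rewrite addnBA// leq_subLR leq_add2r.
Qed.

(* At an associated prime [p] of [R/Z_i] annihilating a multiple of [I], neither
   [I <= p] (where [I_p = (Z_i)_p]) nor [z_{i+1} \in p] is possible. *)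
Let colon_next i b : (i.+1 < d)%N -> depth_ge m (d - i) (Z i) ->
  K i b <-> Z i (zs`_i * b).
Proof.
move=> id dZ; split=> [|Zzb]; first by rewrite mulrC; apply; exact: I_nth.
apply: contrapT => /existsNP[a /not_implyP[Ia Zba]].
have Zzba : Z i (zs`_i * (b * a)) by rewrite mulrA; exact: ideal_mulPr.
have [p [r [pz pr]]] := associated_of_zerodiv R_noetherian Zzba Zba.
have [h ph] := height_exists p R_dim.
have hi := associated_height (ltnW (ltnW id)) dZ pr ph.
have [Ip|/existsNP[c /not_implyP[Ic pc]]] := pselect (I `<=` p).
  have [s ps hs] := geometric (ltnW id) Ip ph hi.
  apply: ps; apply/pr; have -> : s * (r * (b * a)) = r * b * (s * a) by ring.
  by apply: ideal_mulP; exact: hs.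
have [s ps /(_ c Ic)] := residual id ph (hi : (h < i.+1)%N).
rewrite ZS// => hsc; suff /primeM[] : p (s * c) by [].
move: (s * c) hsc; apply: adj_min => //; exact: associated_sub pr.
Qed.

(** An associated prime of R/Z_i that annihilates a multiple of some a in I outside Z_i contains
    K_i, and the depth of R/Z_i puts a chain of length d - i above it. So the Cohen-Macaulay ring
    R/K_i, if nonzero, has large enough dimension. *)
Let depth_colon i : (i.+1 < d)%N -> depth_ge m (d - i) (Z i) ->
  depth_ge m (d - i) (K i).
Proof.
move=> id dZ; apply: cohen_macaulay_depth_ge => //; first exact: residual_CM.
move=> K1; have [a Ia Za] : exists2 a, I a & ~ Z i a.
  apply: contrapT => h; apply: K1 => a Ia; rewrite mul1r.
  by apply: contrapT => Za; apply: h; exists a.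
have [p [r pr]] := associated_exists R_noetherian Za.
exists p; last exact: depth_ge_chain R_noetherian R_local _ _ _ _ dZ pr.
by move=> b Kb; apply/pr; rewrite mulrCA; apply: ideal_mulP; exact: Kb.
Qed.

(** The depth lemma for 0 -> R/K_i -> R/Z_i -> R/Z_(i+1) -> 0, which is exact by [colon_next]. *)
Let depth_Z i : (i < d)%N -> depth_ge m (d - i) (Z i).
Proof.
elim: i => [_|i IHi id]; first by rewrite subn0 /Z take0.
have dZ := IHi (ltnW id); rewrite ZS//.
apply: (depth_ge_cokernel R_noetherian R_local k_infinite (K := K i)).
- by move=> b; exact: colon_next.
- by rewrite subnSK ?(ltnW id)//; exact: depth_colon.
- by apply: depth_ge_le dZ; rewrite leq_sub2l.
Qed.

(** An associated prime of R/Z_i at a multiple of b contains I and has height at most i, where I and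
    Z_i agree locally; this is impossible for b in I. *)
Let sat_cap i b e : (i < d)%N -> I b -> (forall x, (I ^+ e)%ideal x -> Z i (b * x)) ->
  Z i b.
Proof.
move=> id Ib hb; apply: contrapT => Zb.
have [p [r pr]] := associated_exists R_noetherian Zb.
have Ip : I `<=` p.
  apply: (@prime_exp_sub _ _ _ e) => x Ix; apply/pr.
  by rewrite mulrCA mulrC; apply: ideal_mulPr; rewrite mulrC; exact: hb.
have [h ph] := height_exists p R_dim.
have hi := associated_height (ltnW id) (depth_Z id) pr ph.
have [s ps hs] := geometric id Ip ph hi.
by apply: ps; apply/pr; rewrite mulrCA; apply: ideal_mulP; exact: hs.
Qed.

Let colon_cap i b : (i < d)%N -> I b -> K i b -> Z i b.
Proof.
move=> id Ib Kb; apply: (@sat_cap i b 1) => // x; rewrite ideal_exp1; exact: Kb.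
Qed.

Hypothesis I_depth : depth_ge m 1 I.

(* [0 -> R/Z_i -> R/I + R/K_i -> R/(I + K_i) -> 0] with [depth R/Z_i >= 2]. *)
Let socle_add i a : (i.+1 < d)%N -> (forall c, m c -> (K i + I)%ideal (c * a)) ->
  (K i + I)%ideal a.
Proof.
move=> id ha; have id' := ltnW id.
have two : (1 < d - i)%N by rewrite ltn_subRL addn1.
have dZ : depth_ge m 2 (Z i) := depth_ge_le two (depth_Z id').
have dK : depth_ge m 2 (K i) := depth_ge_le two (depth_colon id (depth_Z id')).
have [|x mx hx] := @regular_common _ _ R_noetherian R_local k_infinite [:: K i; I; Z i].
  move=> L [<-|[<-|[<-|[]]]];
  [exact: depth_ge_regular dK|exact: depth_ge_regular I_depth|exact: depth_ge_regular dZ].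
have Kx : regular_mod (K i) x by apply: hx; left.
have Ix : regular_mod I x by apply: hx; right; left.
have Zx : regular_mod (Z i) x by apply: hx; right; right; left.
have [y [my Zy _]] := depth_ge_adj R_noetherian R_local k_infinite mx Zx dZ.
have /mem_ideal_add[k [b [Kk Ib e]]] := ha x mx.
(* The part b of x a = k + b is killed by m modulo Z_i + (x), since c b - x b' lies in both I and
   K_i. That quotient has positive depth. *)
have /mem_adj[z [r [Zz eb]]] : ideal_adj (Z i) x b.
  apply: (regular_socle my Zy) => c mc.
  have /mem_ideal_add[k' [b' [Kk' Ib' e']]] := ha c mc.
  apply/mem_adj; exists (c * b - b' * x), b'; split; last by rewrite subrK.
  apply: colon_cap => //.
    by apply: ideal_subP; [exact: ideal_mulP|exact: ideal_mulPr].
  have -> : c * b - b' * x = x * k' - c * k.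
    transitivity (c * (x * a - k) - x * (c * a - k')); last by ring.
    by rewrite e e'; ring.
  by apply: ideal_subP; exact: ideal_mulP.
have Ir : I r.
  apply: Ix; have -> : x * r = b - z by rewrite eb; ring.
  by apply: ideal_subP => //; exact: ZI Zz.
apply/mem_ideal_add; exists (a - r), r; split=> //; last by rewrite subrK.
apply: Kx; have -> : x * (a - r) = k + z by rewrite mulrBr e eb; ring.
by apply: ideal_addP => // w Iw; exact: ideal_mulPr.
Qed.

Lemma mem_adj_mul L (z x : R) : (ideal_adj L z * I)%ideal x <->
  exists t b, [/\ (L * I)%ideal t, I b & x = t + z * b].
Proof.
split=> [|[t [b [Lt Ib ->]]]]; last first.
  apply: ideal_addP; last by apply: ideal_mul_mem => //; exact: adj_id.
  by move: t Lt; apply: ideal_mul_min => l c Ll Ic; apply: ideal_mul_mem => //; exact: adj_sub.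
have @N : ideal R.
  exists [set x | exists t b, [/\ (L * I)%ideal t, I b & x = t + z * b]].
  - exists 0, 0; rewrite mulr0 addr0; split=> //; exact: ideal_has0.
  - move=> _ _ [t [b [Lt Ib ->]]] [t' [b' [Lt' Ib' ->]]]; exists (t + t'), (b + b').
    by rewrite mulrDr addrACA; split=> //; exact: ideal_addP.
  - move=> a _ [t [b [Lt Ib ->]]]; exists (a * t), (a * b).
    by rewrite mulrDr mulrCA; split=> //; exact: ideal_mulP.
move: x; apply: (@ideal_mul_min _ _ _ N) => _ b /mem_adj[l [a [Ll ->]]] Ib.
exists (l * b), (a * b); rewrite mulrDl mulrCA mulrA; split=> //; last exact: ideal_mulP.
exact: ideal_mul_mem.
Qed.

(** Induction along 0 -> Z_i/Z_i I -> Z_(i+1)/Z_(i+1) I -> R/(I + K_i) -> 0, whose right end has no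
    socle by [socle_add]. Exactness on the left holds since z_(i+1) b in Z_i with b in I puts b in
    the intersection of K_i and I, which is Z_i. *)
Let socle_mul i v : (i < d)%N -> Z i v -> (forall c, m c -> (Z i * I)%ideal (c * v)) ->
  (Z i * I)%ideal v.
Proof.
elim: i v => [|i IHi] v id.
  by rewrite /Z take0 => /mem_span_nil -> _; exact: ideal_has0.
rewrite ZS//; set z := zs`_i; move=> /mem_adj[w [a [Zw e]]] hv.
have ZK b : Z i (z * b) -> K i b by move=> Zzb; apply/colon_next => //; exact/depth_Z/ltnW.
have /mem_ideal_add[k [b [Kk Ib ea]]] : (K i + I)%ideal a.
  apply: socle_add => // c mc; have /mem_adj_mul[t [b [Zt Ib ec]]] := hv c mc.
  apply/mem_ideal_add; exists (c * a - b), b; split=> //; last by rewrite subrK.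
  apply: ZK; have -> : z * (c * a - b) = t - c * w.
    transitivity (c * v - z * b - c * w); first by rewrite e; ring.
    by rewrite ec; ring.
  by apply: ideal_subP; [exact: ideal_mul_subl Zt|exact: ideal_mulP].
apply/mem_adj_mul; exists (v - z * b), b; split=> //; last by rewrite subrK.
apply: IHi; first exact: ltnW.
  have -> : v - z * b = w + k * z by rewrite e ea; ring.
  by apply: ideal_addP => //; apply: Kk; exact: I_nth.
move=> c mc; have /mem_adj_mul[t [b' [Zt Ib' ec]]] := hv c mc.
have eq : c * (v - z * b) = t + z * (b' - c * b).
  by rewrite mulrBr ec; ring.
rewrite eq; apply: ideal_addP => //; rewrite mulrC.
apply: ideal_mul_mem; last exact: I_nth.
apply: colon_cap; [exact: ltnW| |].
  by apply: ideal_subP => //; exact: ideal_mulP.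
apply: ZK.
have -> : z * (b' - c * b) = c * (w + k * z) - t.
  have -> : w + k * z = v - z * b by rewrite e ea; ring.
  by rewrite eq; ring.
apply: ideal_subP; last exact: ideal_mul_subl Zt.
apply: ideal_mulP; apply: ideal_addP => //; apply: Kk; exact: I_nth.
Qed.

(** By [sat_cap], z lies in Z = Z_(d-1). Let p be an associated prime of R/Z I at a multiple of z.
    If p = m, [socle_mul] applies. If p < m contains I, then I_p = Z_p and I^2 agrees with Z I at p.
    If p does not contain I, then z I <= Z I is already a contradiction. *)
Lemma residual_sat_cap z : ideal_sat (ideal_span zs) I z -> (I ^+ 2)%ideal z ->
  (ideal_span zs * I)%ideal z.
Proof.
have d1 : (d.-1 < d)%N by rewrite prednK.
have eZ : ideal_span zs = Z d.-1 by rewrite /Z -zs_size take_size.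
rewrite eZ => -[e e0 hz] I2z; have Zz : Z d.-1 z.
  by apply: sat_cap hz => //; exact: (@ideal_exp_sub1 _ _ 2).
apply: contrapT => nz.
have [p [r pr]] := associated_exists R_noetherian nz.
have [mp|nmp] := pselect (m `<=` p).
  apply: (associated_notin pr); apply: socle_mul => //; first exact: ideal_mulP.
  by move=> c /mp/pr.
have [h ph] := height_exists p R_dim.
have hd : (h < d)%N.
  have [h' mh'] := height_exists (prime_max m) R_dim.
  have pm : p `<` prime_max m by split=> //; exact: local_prime.
  apply: leq_trans (height_lt pm ph mh') _.
  by rewrite -[h']addn0; apply: (height_chain_le R_dim (proj1 mh')).
have [Ip|/existsNP[a /not_implyP[Ia pa]]] := pselect (I `<=` p).
  have hd1 : (h <= d.-1)%N by rewrite -ltnS prednK.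
  have [s ps hs] := geometric d1 Ip ph hd1.
  apply: ps; apply/pr; rewrite mulrCA; apply: ideal_mulP.
  pose N := ideal_colon (Z d.-1 * I)%ideal (ideal_span [:: s]).
  suff : N z.
    by move=> /(_ s (span_mem (mem_head _ _))); rewrite mulrC.
  move: z I2z {hz Zz nz pr}; rewrite ideal_exp2; apply: ideal_mul_min => a b Ia Ib.
  move=> _ /mem_span1[c ->]; have -> : a * b * (c * s) = c * (s * a * b) by ring.
  by apply: ideal_mulP; apply: ideal_mul_mem => //; exact: hs.
apply: pa; apply/pr; rewrite mulrCA; apply: ideal_mulP; rewrite mulrC.
exact: ideal_mul_mem.
Qed.

End ResidualDepth.

(** * The saturation of H_(d-1) inside I^2, under either hypothesis *)

Section SaturationCap.
Variables (R : comNzRingType) (m : maxideal R) (d : nat) (I : ideal R).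
Hypotheses (R_noetherian : noetherian R) (R_local : local_ring m).
Hypothesis k_infinite : infinite_set [set: residue_field m].
Hypotheses (R_CM : cohen_macaulay R) (R_dim : has_krull_dim R d) (d_gt0 : (0 < d)%N).
Hypothesis I_proper : is_proper I.

Lemma cohen_macaulay_ring_depth : depth_ge m d (ideal_span [::]).
Proof.
case: R_CM => [/eqP|[n [dimn depthn]]]; first by rewrite oner_eq0.
by rewrite (has_krull_dim_uniq R_dim dimn); exact: depth_ge_has_depth.
Qed.

Lemma primary_sat_cap (y : d.-tuple R) :
  reduction (ideal_span y) I -> primary_to m I ->
  (ideal_span y :&: I ^+ 2 = ideal_span y * I)%ideal ->
  forall z, ideal_sat (ideal_span (take d.-1 y)) I z -> (I ^+ 2)%ideal z ->
    (ideal_span y * I)%ideal z.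
Proof.
move=> [yI [n redn]] [_ radI] capI z [e e0 hz] I2z.
rewrite -capI; split=> //.
have dS : d = d.-1.+1 by rewrite prednK.
have ey : (y : seq R) = rcons (take d.-1 y) y`_d.-1.
  by rewrite -take_nth ?size_tuple// prednK// take_oversize// size_tuple.
have yd : y`_d.-1 \in (y : seq R) by rewrite mem_nth// size_tuple prednK.
have ym x : x \in (y : seq R) -> m x.
  move=> /span_mem/yI Ix; exact: (local_proper R_noetherian R_local I_proper).
have reg : regular_list (ideal_span [::]) y.
  apply: (parameters_regular R_noetherian R_local k_infinite) => //.
    by rewrite size_tuple; exact: cohen_macaulay_ring_depth.
  (* A prime containing H contains I^(n+1) = H I^n, hence I, hence m, so y is a system of
     parameters. *)
  move=> p hp x; rewrite -radI => -[k Ixk].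
  apply: (@prime_expX _ p _ k); apply: (@prime_exp_sub _ p I n.+1) Ixk.
  rewrite redn => w /ideal_mul_subl yw; apply: hp; exact: ideal_add_subr.
have {}reg : regular_mod (ideal_span (take d.-1 y)) y`_d.-1.
  move: reg; rewrite {1}ey.
  suff h (L : ideal R) (s : seq R) x : regular_list L (rcons s x) ->
      regular_mod (L + ideal_span s)%ideal x.
    by move=> /h; rewrite -span_cat.
  elim: s L => [|w s IHs] L /=.
    move=> [Lx _] b Lxb; apply: ideal_add_subl; apply: Lx.
    by move: Lxb => /mem_ideal_add[l [t [Ll /mem_span_nil -> ->]]]; rewrite addr0.
  by move=> [_ /IHs]; rewrite add_span_cons.
have : ideal_span (take d.-1 y) z.
  have : ideal_span (take d.-1 y) (y`_d.-1 ^+ e * z).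
    rewrite mulrC; apply: hz; apply: mem_ideal_expX; exact/yI/span_mem.
  elim: (e) => [|j IHj]; first by rewrite mul1r.
  by rewrite exprS -mulrA => /reg.
by move: z {hz I2z}; apply: span_min => x /mem_take; exact: span_mem.
Qed.

(** Denominators are units in R_p, so the numerators of the generators generate as well. *)
Lemma gens_at_of_loc (p : primeideal R) (g : seq (loc p)) :
  loc_ideal p I = ideal_span g -> gens_at I p (ideal_span [::]) (size g).
Proof.
move=> eg; have [g' [sg' g'I gg']] : exists g' : seq R, [/\ size g' = size g,
    forall x, x \in g' -> I x & ideal_span g `<=` loc_ideal p (ideal_span g')].
  have : forall x, x \in g -> loc_ideal p I x by move=> x /span_mem; rewrite eg.
  elim: (g) => [_|x t IHt h].
    by exists [::]; split=> // z /mem_span_nil ->; exact: ideal_has0.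
  have [|t' [st' t'I tt']] := IHt; first by move=> z zt; apply: h; rewrite in_cons zt orbT.
  have /mem_loc_ideal[u [Iu ex]] := h x (mem_head _ _).
  exists ((val u).1 :: t'); split; first by rewrite /= st'.
    by move=> z; rewrite in_cons => /predU1P[->//|/t'I].
  apply: span_min => z; rewrite in_cons => /predU1P[->|/span_mem/tt'].
    by rewrite ex; apply/mem_loc_ideal; exists u; split=> //; exact: span_mem (mem_head _ _).
  move=> /mem_loc_ideal[v [tv ->]]; apply/mem_loc_ideal; exists v; split=> //.
  by apply/mem_span_cons; exists 0, (val v).1; rewrite mul0r add0r.
exists g'; split; [by rewrite sg'|exact: g'I|].
by rewrite -span_cat /= -(loc_subP _ _ _ R_noetherian) eg.
Qed.

Lemma loc_ideal_eq (p : primeideal R) (L : ideal R) : L `<=` I -> loc_sub p I L ->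
  loc_ideal p I = loc_ideal p L.
Proof.
move=> LI IL; apply/ideal_eq/seteqP; split; first exact/(loc_subP _ _ _ R_noetherian).
by apply/(loc_subP _ _ _ R_noetherian); exact: sub_loc_sub.
Qed.

Lemma eq_loc_sub (p : primeideal R) (L : ideal R) :
  loc_ideal p I = loc_ideal p L -> loc_sub p I L.
Proof. by move=> e; apply/(loc_subP _ _ _ R_noetherian); rewrite e. Qed.

Lemma residual_sat_cap_ring (ys : seq R) : size ys = d.-1 ->
  (exists2 n, has_depth (quot I) n & (1 <= n)%N) ->
  G_condition I d -> AN_minus I (d%:Z - 2) -> geometric_residual_intersection ys I ->
  forall z, ideal_sat (ideal_span ys) I z -> (I ^+ 2)%ideal z ->
    (ideal_span ys * I)%ideal z.
Proof.
move=> sys [n dI n1] GI ANI [[ysI ysr] ysg].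
have Yl p h : height p h -> (h < d.-1)%N -> loc_sub p I (ideal_span ys).
  by move=> /loc_krull_dim ph hd; apply/eq_loc_sub/(ysr p h) => //; rewrite sys.
have Yb (p : primeideal R) h : I `<=` p -> height p h -> (h < d)%N ->
    loc_sub p I (ideal_span ys).
  move=> Ip /loc_krull_dim ph hd; apply/eq_loc_sub/(ysg p h) => //.
  by rewrite sys -ltnS prednK.
have G0 : gens_bound d I (ideal_span [::]) 0.
  move=> p h Ip /loc_krull_dim ph hd; rewrite subn0.
  by have [g /gens_at_of_loc] := GI p h Ip ph hd; rewrite size_tuple.
have [zs [szs ezs hzs]] := residual_generators R_noetherian R_local k_infinite
  R_dim sys ysI G0 Yl Yb.
have zsI z : z \in zs -> I z.
  by move=> /span_mem; rewrite ezs; exact: span_min ysI z.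
have ZI i : ideal_span (take i zs) `<=` I by apply: span_min => z /mem_take/zsI.
have geo i (p : primeideal R) h : (i < d)%N -> I `<=` p -> height p h -> (h <= i)%N ->
    loc_sub p I (ideal_span (take i zs)).
  move=> id Ip ph hi; have [|Zb _] := hzs i; first by rewrite szs sys -ltnS prednK.
  have := Zb p h Ip ph (leq_ltn_trans hi id).
  by rewrite (eqP (_ : h - i == 0)%N) ?subn_eq0//; exact: gens_at0.
have res i (p : primeideal R) h : (i < d)%N -> height p h -> (h < i)%N ->
    loc_sub p I (ideal_span (take i zs)).
  move=> id ph hi; have [Ip|nIp] := pselect (I `<=` p).
    by apply: geo ph _ => //; exact: ltnW.
  have [|_ Zl] := hzs i; first by rewrite szs sys -ltnS prednK.
  have /existsNP[s /not_implyP[Zs ps]] := Zl p h nIp ph hi.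
  by exists s => // x _; exact: ideal_mulPr.
rewrite -ezs; apply: (residual_sat_cap R_noetherian R_local k_infinite R_dim) => //.
- exact: cohen_macaulay_ring_depth.
- by rewrite szs.
- move=> i id; have si : size (take i zs) == i.
    by rewrite size_takel// szs sys; case: (d) id => // -[|d'] // id; exact: ltnW.
  apply: (ANI i (Tuple si)).
    by rewrite Num.Theory.lerBrDr -PoszD lez_nat addn2.
  split; first split.
  - by move=> x /mem_take/zsI.
  - move=> p h /loc_krull_dim ph; rewrite (eqP si) => hi.
    apply: loc_ideal_eq; [exact: ZI|apply: res ph hi; exact: ltnW].
  - move=> p h Ip /loc_krull_dim ph; rewrite (eqP si) => hi.
    apply: loc_ideal_eq; [exact: ZI|apply: geo Ip ph hi; exact: ltnW].
- exact: depth_ge_le n1 (depth_ge_quot R_noetherian R_local dI).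
Qed.

End SaturationCap.
(** * Polynomials over an infinite field *)

Section InfiniteField.
Variable k : fieldType.
Hypothesis k_infinite : infinite_set [set: k].

Lemma infinite_uniq n : exists2 s : seq k, uniq s & size s = n.
Proof.
elim: n => [|n [s us sn]]; first by exists [::].
by have [x xs] := infinite_notin s k_infinite; exists (x :: s); rewrite /= ?xs ?sn.
Qed.

Lemma poly_nonroot (p : {poly k}) : p != 0 -> exists x, p.[x] != 0.
Proof.
move=> p0; apply: contrapT => h; have [s us sp] := infinite_uniq (size p).
have : all (root p) s.
  by apply/allP => x _; apply: contrapT => /negP px; apply: h; exists x.
by move=> /(max_poly_roots p0)/(_ us); rewrite sp ltnn.
Qed.

Lemma radix_inj (D n : nat) (a b : 'I_n -> nat) :
  (forall i, (a i < D)%N) -> (forall i, (b i < D)%N) ->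
  (\sum_(i < n) a i * D ^ i = \sum_(i < n) b i * D ^ i)%N -> a =1 b.
Proof.
elim: n a b => [|n IHn] a b aD bD; first by move=> _ [].
have split c : (\sum_(i < n.+1) c i * D ^ i
    = (\sum_(i < n) c (lift ord0 i) * D ^ i) * D + c ord0)%N.
  rewrite big_ord_recl expn0 muln1 addnC big_distrl /=; congr (_ + _)%N.
  by apply: eq_bigr => i _; rewrite expnS mulnCA mulnC.
rewrite !split => e.
have ab0 : a ord0 = b ord0.
  by have := congr1 (modn^~ D) e; rewrite !modnMDl !modn_small.
have D0 : (0 < D)%N by apply: leq_ltn_trans (aD ord0).
have {e} /IHn h : (\sum_(i < n) a (lift ord0 i) * D ^ i
                 = \sum_(i < n) b (lift ord0 i) * D ^ i)%N.
  by move: e; rewrite ab0 => /addIn/eqP; rewrite eqn_pmul2r// => /eqP.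
by move=> i; case: (unliftP ord0 i) => [j ->|->//]; exact: h.
Qed.

(* Kronecker's substitution [X_i := t ^ (D ^ i)] with [D] larger than all degrees
   separates the monomials. *)
Lemma mpoly_nonroot n (f : {mpoly k[n]}) : f != 0 -> exists v, f.@[v] != 0.
Proof.
move=> f0; pose D := msize f.
pose e (u : 'X_{1..n}) := (\sum_(i < n) u i * D ^ i)%N.
have uD u i : u \in msupp f -> (u i < D)%N.
  move=> uf; apply: leq_ltn_trans (msize_mdeg_lt uf).
  by rewrite mdegE (bigD1 i)//= leq_addr.
have einj u v : u \in msupp f -> v \in msupp f -> e u = e v -> u = v.
  move=> uf vf euv; apply/mnmP; apply: radix_inj euv => i; exact: uD.
pose g : {poly k} := \sum_(u <- msupp f) f@_u *: 'X^(e u).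
have [u uf] : exists u, u \in msupp f.
  case E : (msupp f) => [|u s]; last by exists u; rewrite mem_head.
  by move: f0; rewrite -msupp_eq0 E.
have /poly_nonroot[t gt] : g != 0.
  apply/eqP => /(congr1 (fun p : {poly k} => p`_(e u))); rewrite coef0 coef_sum.
  rewrite (bigD1_seq u)//= ?msupp_uniq// big_seq_cond big1 ?addr0 => [|v /andP[vf vu]].
    by rewrite coefZ coefXn eqxx mulr1 => /eqP; rewrite mcoeff_eq0 uf.
  rewrite coefZ coefXn; case: eqP => [euv|]; last by rewrite mulr0.
  by rewrite (einj _ _ uf vf euv) eqxx in vu.
exists (fun i => t ^+ (D ^ i)); move: gt; rewrite mevalE /g horner_sum.
congr (_ != 0); apply: eq_bigr => v _; rewrite hornerZ hornerXn; congr (_ * _).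
by rewrite -prodrXr; apply: eq_bigr => i _; rewrite -exprM mulnC.
Qed.

(** For density: a nonempty open set contains the nonvanishing locus of some g != 0, and f g is not
    zero everywhere. *)
Lemma mpoly_open_dense n (f : {mpoly k[n]}) : f != 0 ->
  zariski_open [set v | f.@[v] != 0] /\ zariski_dense [set v | f.@[v] != 0].
Proof.
move=> f0; split.
  exists [set f]; apply/predeqP => v /=; split=> [/eqP fv h|h].
    by apply: fv; apply: h.
  by apply/eqP => fv; apply: h => g ->.
move=> V [S ->] [v /existsNP[g /not_implyP[Sg gv]]].
have g0 : g != 0 by apply/eqP => e; apply: gv; rewrite e meval0.
have [w] := @mpoly_nonroot n _ (mulf_neq0 f0 g0); rewrite mevalM mulf_eq0 negb_or.
move=> /andP[fw gw]; exists w; split=> // h.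
by rewrite (h _ Sg) eqxx in gw.
Qed.

End InfiniteField.

Lemma meval_map (A B : comNzRingType) (f : {rmorphism A -> B}) n
    (p : {mpoly A[n]}) (v : 'I_n -> A) :
  (map_mpoly f p).@[fun i => f (v i)] = f p.@[v].
Proof.
have -> : map_mpoly f p = \sum_(u <- msupp p) f p@_u *: 'X_[u].
  rewrite {1}(mpolyE p) (raddf_sum (map_mpoly f)); apply: eq_bigr => u _.
  by rewrite /= map_mpolyZ map_mpolyX.
rewrite [in RHS]mevalE (rmorph_sum f) (raddf_sum (meval _)); apply: eq_bigr => u _.
rewrite /= mevalZ mevalX rmorphM /=; congr (_ * _).
by rewrite rmorph_prod; apply: eq_bigr => i _; rewrite rmorphXn.
Qed.

(** * Lengths for generic coefficients *)

Section GenericMaximal.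
Variables (R : comNzRingType) (m : maxideal R) (N : nat).
Hypotheses (R_noetherian : noetherian R) (R_local : local_ring m).
Implicit Types (l : 'I_N -> R).

Lemma minimal_generators (I : ideal R) : exists2 s : seq R, I = ideal_span s &
  forall c : nat -> R, \sum_(i < size s) c i * s`_i = 0 ->
    forall i, (i < size s)%N -> m (c i).
Proof.
have ex : exists n, `[< exists2 s : seq R, I = ideal_span s & size s = n >].
  by have [s Is] := R_noetherian I; exists (size s); apply/asboolP; exists s.
have [n /asboolP[s Is sn] nmin] := ex_minnP ex.
exists s => // c c0 i i_s; apply: contrapT => mci.
suff : (size s <= size (delete_nth s i))%N by rewrite -(size_delete_nth i_s) ltnn.
rewrite [X in (X <= _)%N]sn; apply: nmin; apply/asboolP; exists (delete_nth s i) => //.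
rewrite Is; apply: ideal_eqP => z; split; move: z; apply: span_min => x.
  move=> /(nthP 0)[j js <-]; have [->|ji] := eqVneq j i; last first.
    by apply: span_mem; exact: nth_in_delete_nth.
  apply: (local_unitM R_noetherian R_local mci).
  have -> : c i * s`_i = - \sum_(j < size s | j != Ordinal i_s) c j * s`_j.
    by move: c0; rewrite (bigD1 (Ordinal i_s))// => /eqP; rewrite addr_eq0 => /eqP.
  apply: ideal_oppP; apply: ideal_sumP => k ki; apply: ideal_mulP; apply: span_mem.
  by apply: nth_in_delete_nth => //; apply: contra_neq ki => kE; exact: val_inj.
by move=> /mem_delete_nth/span_mem.
Qed.

Lemma residue_meval (p : {mpoly R[N]}) l :
  (map_mpoly (residue m) p).@[fun i => residue m (l i)] = residue m p.@[l].
Proof. exact (@meval_map R (residue_field m) (residue m) N p l). Qed.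

(* If some [P_i] is nonzero modulo [m], this is clear. Otherwise write
   [P_i = \sum_j s_j Q_ij] with minimal generators [s_j] of [m]; a constant
   combination of the rows of [Q] is invertible at [l0], hence generically. *)
Lemma generic_maximal (P : seq {mpoly R[N]}) l0 :
  m `<=` ideal_span [seq p.@[l0] | p <- P] ->
  exists2 f : {mpoly (residue_field m)[N]}, f != 0 &
    forall l, f.@[fun i => residue m (l i)] != 0 ->
      m `<=` ideal_span [seq p.@[l] | p <- P].
Proof.
move=> ml0.
have [[p [pP p0]]|allP0] := pselect (exists p, p \in P /\ map_mpoly (residue m) p != 0).
  exists (map_mpoly (residue m) p) => // l; rewrite residue_meval => /eqP pl x _.
  apply: (@local_unitM _ _ R_noetherian R_local p.@[l]); first by move/residue_eq0.
  by apply: ideal_mulPr; apply: span_mem; apply/mapP; exists p.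
have [s ms smin] := minimal_generators m.
have /choice[Q hQ] : forall i : 'I_(size P), exists q : 'I_(size s) -> {mpoly R[N]},
    P`_i = \sum_(j < size s) s`_j *: q j.
  move=> i; set p := P`_i; have pP : p \in P by rewrite mem_nth.
  have pm u : m p@_u.
    apply/residue_eq0; rewrite -mcoeff_map_mpoly.
    have -> : map_mpoly (residue m) p = 0; last by rewrite mcoeff0.
    by apply/eqP; apply: contrapT => /negP p0; apply: allP0; exists p.
  rewrite [p]mpolyE; pose good p := exists q : 'I_(size s) -> {mpoly R[N]},
    p = \sum_(j < size s) s`_j *: q j.
  apply: (big_ind good).
  - by exists (fun=> 0); rewrite big1// => j _; rewrite scaler0.
  - move=> _ _ [q ->] [q' ->]; exists (fun j => q j + q' j).
    by rewrite -big_split; apply: eq_bigr => j _; rewrite scalerDr.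
  - move=> u _; move: (pm u); rewrite ms => /mem_span[c ->].
    exists (fun j => c j *: 'X_[u]); rewrite scaler_suml; apply: eq_bigr => j _.
    by rewrite scalerA mulrC.
have hQl l (i : 'I_(size P)) : (P`_i).@[l] = \sum_(j < size s) (Q i j).@[l] * s`_j.
  rewrite hQ raddf_sum; by apply: eq_bigr => j _; rewrite /= mevalZ mulrC.
have /choice[C hC] : forall j : 'I_(size s), exists c : nat -> R,
    s`_j = \sum_(i < size P) c i * (P`_i).@[l0].
  move=> j; have /ml0/mem_span[c ->] : m s`_j by rewrite ms; exact: span_nth.
  exists c; rewrite size_map; apply: eq_bigr => i _.
  by rewrite (nth_map 0).
(* With M = C Q, M(l) s = C P(l) for every l. At l0 this is s, so M(l0) is the identity modulo m by
   minimality of s. Where det M is a unit, the adjugate recovers s from the P_i(l). *)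
pose CM : 'M[{mpoly R[N]}]_(size s, size P) := \matrix_(j, i) (C j i)%:MP.
pose QM : 'M[{mpoly R[N]}]_(size P, size s) := \matrix_(i, j) Q i j.
pose M := CM *m QM.
have ME l j j' : (M j j').@[l] = \sum_(i < size P) C j i * (Q i j').@[l].
  rewrite mxE raddf_sum; apply: eq_bigr => i _.
  by rewrite !mxE /= mevalM mevalC.
have detE l : (\det M).@[l] = \det (map_mx (meval l) M).
  by rewrite (det_map_mx (meval l)).
exists (map_mpoly (residue m) (\det M)).
  apply: contraTneq isT => e0.
  have := residue_meval (\det M) l0; rewrite e0 meval0 detE -det_map_mx.
  have -> : map_mx (residue m) (map_mx (meval l0) M) = 1%:M.
    apply/matrixP => j j'; rewrite [LHS]mxE [map_mx _ _ _ _]mxE [RHS]mxE.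
    rewrite -[RHS](rmorph_nat (residue m)).
    pose c j' := if insub j' is Some j'' then (M j j'').@[l0] - (j == j'')%:R else 0.
    have cE (k : 'I_(size s)) : c k = (M j k).@[l0] - (j == k)%:R by rewrite /c valK.
    apply/residue_eq; rewrite -cE; apply: smin => //.
    under eq_bigr do rewrite cE mulrBl.
    rewrite sumrB [X in _ - X](bigD1 j)//= eqxx mul1r [X in _ - (_ + X)]big1 ?addr0; last first.
      by move=> k kj; rewrite eq_sym (negPf kj) mul0r.
    rewrite [X in _ - X]hC; apply/eqP; rewrite subr_eq0; apply/eqP.
    under eq_bigr do rewrite ME mulr_suml.
    rewrite exchange_big; apply: eq_bigr => i _; rewrite hQl mulr_sumr.
    by apply: eq_bigr => k _; rewrite mulrA.
  by rewrite det1 => /esym e1; move: (oner_neq0 (residue_field m)); rewrite e1 eqxx.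
move=> l; rewrite residue_meval => /eqP fl.
have {}fl : ~ m (\det (map_mx (meval l) M)) by rewrite -detE => /residue_eq0.
rewrite {1}ms; apply: span_min => _ /(nthP 0)[j js <-].
apply: (local_unitM R_noetherian R_local fl).
set A := map_mx _ M in fl *; pose v : 'cV[R]_(size s) := \col_j s`_j.
have -> : \det A * s`_j = (\adj A *m (A *m v)) (Ordinal js) 0.
  by rewrite mulmxA mul_adj_mx mul_scalar_mx !mxE.
rewrite mxE; apply: ideal_sumP => j' _; apply: ideal_mulP.
have -> : (A *m v) j' 0 = \sum_(i < size P) C j' i * (P`_i).@[l].
  rewrite mxE; under eq_bigr do rewrite mxE ME mxE mulr_suml.
  rewrite exchange_big; apply: eq_bigr => i _; rewrite hQl mulr_sumr.
  by apply: eq_bigr => j'' _; rewrite mulrA.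
apply: ideal_sumP => i _; apply: ideal_mulP; apply: span_mem.
by apply: map_f; rewrite mem_nth.
Qed.

End GenericMaximal.
(** Sylvester's determinant identity in rank one, from two triangular factorizations of the same
    block matrix. *)
Lemma det_1B_rank1 (R : comNzRingType) n (c : 'cV[R]_n) (w : 'rV[R]_n) :
  \det (1%:M - c *m w) = 1 - (w *m c) 0 0.
Proof.
pose A := block_mx 1%:M c w (1%:M : 'M_1).
have e1 : A = block_mx 1%:M 0 w 1%:M *m block_mx 1%:M c 0 (1%:M - w *m c).
  by rewrite mulmx_block !mul1mx !mul0mx mulmx1 !addr0 addrC subrK.
have e2 : A = block_mx 1%:M c 0 1%:M *m block_mx (1%:M - c *m w) 0 w 1%:M.
  by rewrite mulmx_block !mul1mx !mul0mx !mulmx1 !add0r subrK.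
transitivity (\det A).
  by rewrite e2 det_mulmx det_ublock det_lblock !det1 !mul1r mulr1.
by rewrite e1 det_mulmx det_ublock det_lblock !det1 !mul1r det_mx11 !mxE.
Qed.

(** * Deformation of the module I^2/(H I + I^3) *)

Section GenericLength.
Variables (R : comNzRingType) (m : maxideal R) (I : ideal R) (d : nat) (a : seq R).
Hypotheses (R_noetherian : noetherian R) (R_local : local_ring m).
Hypothesis Ia : I = ideal_span a.
Implicit Types (c : 'M[R]_(d, size a)).

Definition combinations c : d.-tuple R :=
  [tuple \sum_(j < size a) c i j * a`_j | i < d].

Definition num c : ideal R := (ideal_span (combinations c) * I + I ^+ 3)%ideal.

Definition coords c : 'I_(d * size a) -> R := fun e => mxvec c 0 e.

Variables (mu : nat) (b : 'cV[R]_mu).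
Hypothesis b_mem : forall q, (I ^+ 2)%ideal (b q 0).
Hypothesis b_gen : forall z, (I ^+ 2)%ideal z -> exists u : 'rV_mu, z = (u *m b) 0 0.

Local Notation elt u := ((u *m b) 0 0).
Local Notation ev c := (map_mx (meval (coords c))).

Let ev_const c p q (A : 'M[R]_(p, q)) : ev c (map_mx (@mpolyC _ R) A) = A.
Proof. by apply/matrixP => i j; rewrite !mxE mevalC. Qed.

(* If [u = sum_i g_i y_i] modulo [I ^ 3], with [g_i] in [I], then add to [u] the
   terms [g_i (x_i - y_i)], where [x_i] has indeterminate coefficients. *)
Lemma num_lift c0 (u : 'rV[R]_mu) : num c0 (elt u) ->
  exists rho : 'rV[{mpoly R[d * size a]}]_mu,
    ev c0 rho = u /\ forall c, num c (elt (ev c rho)).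
Proof.
move=> /mem_ideal_add[h [t [/mem_span_mul[g [Ig hE]] I3t e]]].
have /choice[ka hka] : forall ij : 'I_d * 'I_(size a), exists v : 'rV[R]_mu,
    g ij.1 * a`_ij.2 = elt v.
  move=> ij; apply: b_gen; rewrite ideal_exp2; apply: ideal_mul_mem => //.
  by rewrite [X in ideal_set X]Ia; exact: span_nth.
pose rho : 'rV[{mpoly R[d * size a]}]_mu := map_mx (@mpolyC _ R) u +
  \sum_ij ('X_(mxvec_index ij.1 ij.2) - (c0 ij.1 ij.2)%:MP) *: map_mx (@mpolyC _ R) (ka ij).
have evE c : ev c rho = u + \sum_ij (c ij.1 ij.2 - c0 ij.1 ij.2) *: ka ij.
  rewrite map_mxD ev_const raddf_sum; congr (_ + _); apply: eq_bigr => ij _.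
  by rewrite /= map_mxZ ev_const /= mevalB mevalXU mevalC /coords mxvecE.
exists rho; split=> [|c].
  by rewrite evE big1 ?addr0// => ij _; rewrite subrr scale0r.
have -> : elt (ev c rho) = t + \sum_(i < d) g i * (combinations c)`_i.
  have sE : elt (\sum_ij (c ij.1 ij.2 - c0 ij.1 ij.2) *: ka ij)
      = \sum_(i < d) \sum_(j < size a) (c i j - c0 i j) * (g i * a`_j).
    rewrite pair_bigA mulmx_suml summxE; apply: eq_bigr => ij _.
    by rewrite -scalemxAl mxE -hka.
  rewrite evE mulmxDl mxE sE e addrAC addrC; congr (_ + _).
  rewrite hE size_tuple -big_split; apply: eq_bigr => i _.
  rewrite -!tnth_nth !tnth_mktuple !mulr_sumr -big_split.
  by apply: eq_bigr => j _ /=; ring.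
apply: ideal_addP; first exact: ideal_add_subr.
apply: ideal_add_subl; apply/mem_span_mul; exists g; split=> //.
by rewrite size_tuple.
Qed.

(** Cramer's rule: the rows of A are relations modulo L between the generators b of I^2, so det A
    kills each generator modulo L. *)
Lemma num_det (L : ideal R) (A : 'M[R]_mu) z :
  (forall q, L (elt (row q A))) -> (I ^+ 2)%ideal z -> L (\det A * z).
Proof.
move=> LA /b_gen[u ->]; rewrite mxE mulr_sumr; apply: ideal_sumP => q _.
rewrite mulrCA; apply: ideal_mulP.
have -> : \det A * b q 0 = (\adj A *m (A *m b)) q 0.
  by rewrite mulmxA mul_adj_mx mul_scalar_mx mxE.
rewrite mxE; apply: ideal_sumP => q' _; apply: ideal_mulP.
by have := LA q'; rewrite -row_mul mxE.
Qed.

(** The relations b_q = C_q w and s_j w = 0 at c0, with s_j generating m, lift to relations at every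
    c. By [num_det] the lifts yield one determinant certifying that w generates and several that
    annihilate I^2 modulo [num c]; [generic_maximal] handles the latter. *)
Lemma generic_num c0 (w : 'rV[R]_mu) :
  (I ^+ 2)%ideal `<=` ideal_adj (num c0) (elt w) ->
  (forall r, m r -> num c0 (r * elt w)) ->
  exists2 f : {mpoly (residue_field m)[d * size a]}, f != 0 &
    forall c, f.@[fun e => mxvec (map_mx (residue m) c) 0 e] != 0 ->
      (I ^+ 2)%ideal `<=` ideal_adj (num c) (elt w) /\
      forall r z, m r -> (I ^+ 2)%ideal z -> num c (r * z).
Proof.
move=> genw socw.
have /choice[ga hga] : forall q, exists r, num c0 (b q 0 - r * elt w).
  move=> q; have /mem_adj[n [r [Nn ->]]] := genw _ (b_mem q).
  by exists r; rewrite addrK.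
pose C : 'cV[R]_mu := \col_q ga q.
have /choice[rho hrho] : forall q, exists rho : 'rV[{mpoly R[d * size a]}]_mu,
    ev c0 rho = row q (1%:M - C *m w) /\ forall c, num c (elt (ev c rho)).
  move=> q; apply: num_lift.
  rewrite -row_mul mulmxBl mul1mx mxE mxE [X in _ + X]mxE -mulmxA mxE big_ord1.
  by rewrite [C q 0]mxE; exact: hga.
pose G0 := \matrix_q rho q.
have G0E c q : row q (ev c G0) = ev c (rho q) by rewrite -map_row rowK.
have G0c0 : ev c0 G0 = 1%:M - C *m w.
  by apply/row_matrixP => q; rewrite G0E (hrho q).1.
have [s ms] := R_noetherian m.
have /choice[ta hta] : forall j : 'I_(size s), exists ta : 'rV[{mpoly R[d * size a]}]_mu,
    ev c0 ta = s`_j *: w /\ forall c, num c (elt (ev c ta)).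
  move=> j; apply: num_lift; rewrite -scalemxAl mxE; apply: socw.
  by rewrite ms; exact: span_nth.
pose CM := map_mx (@mpolyC (d * size a) R) C.
(* Adding multiples of the lift of s_j w = 0 keeps the rows relations and turns 1 - C w into 1 - (1
   - s_j) C w at c0. *)
pose G j := G0 + CM *m ta j.
have rowD (A B : 'M[R]_mu) q : row q (A + B) = row q A + row q B.
  by apply/rowP => j; rewrite !mxE.
have eltD (u v : 'rV[R]_mu) : elt (u + v) = elt u + elt v by rewrite mulmxDl mxE.
have Grow c j q : num c (elt (row q (ev c (G j)))).
  rewrite map_mxD map_mxM ev_const rowD eltD G0E row_mul.
  apply: ideal_addP; first exact: (hrho q).2.
  have -> : row q C = (ga q)%:M by apply/matrixP => i j'; rewrite !ord1 !mxE mulr1n.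
  by rewrite mul_scalar_mx -scalemxAl mxE; apply: ideal_mulP; exact: (hta j).2.
have detE c (A : 'M[{mpoly R[d * size a]}]_mu) : (\det A).@[coords c] = \det (ev c A).
  by rewrite (det_map_mx (meval (coords c))).
(* At c0 this is the identity; at every c its rows give elements of [num c] plus multiples of w.
   Hence w generates wherever det D is a unit. *)
pose D := G0 + map_mx (@mpolyC _ R) (C *m w).
pose P := \det G0 :: [seq \det (G j) | j <- enum 'I_(size s)].
have mP : m `<=` ideal_span [seq p.@[coords c0] | p <- P].
  rewrite ms; apply: span_min => _ /(nthP 0)[j js <-].
  pose u := (w *m C) 0 0.
  have P0 : ideal_span [seq p.@[coords c0] | p <- P] (1 - u).
    apply: span_mem; apply/mapP; exists (\det G0); first exact: mem_head.
    by rewrite detE G0c0 det_1B_rank1.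
  have Pj : ideal_span [seq p.@[coords c0] | p <- P] (1 - u + s`_j * u).
    apply: span_mem; apply/mapP; exists (\det (G (Ordinal js))).
      rewrite in_cons; apply/orP; right; apply/mapP.
      by exists (Ordinal js); rewrite ?mem_enum.
    rewrite detE map_mxD map_mxM ev_const G0c0 (hta (Ordinal js)).1 /=.
    have -> : 1%:M - C *m w + C *m (s`_j *: w) = 1%:M - C *m ((1 - s`_j) *: w).
      by rewrite scalerBl scale1r mulmxBr opprB addrA addrAC.
    rewrite det_1B_rank1 -scalemxAl [in RHS]mxE -/u; ring.
  have -> : s`_j = (1 - u + s`_j * u) - (1 - u) + s`_j * (1 - u) by ring.
  by apply: ideal_addP; [exact: ideal_subP|exact: ideal_mulP].
have [f1 f10 hf1] := @generic_maximal R m _ R_noetherian R_local P (coords c0) mP.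
pose f2 := map_mpoly (residue m) (\det D).
have cE c : (fun e => mxvec (map_mx (residue m) c) 0 e) = (fun e => residue m (coords c e)).
  by apply: funext => e; rewrite -map_mxvec mxE.
have f2E c : f2.@[fun e => mxvec (map_mx (residue m) c) 0 e] = residue m (\det (ev c D)).
  by rewrite cE residue_meval detE.
have f20 : f2 != 0.
  apply: contraTneq isT => e0; have := f2E c0; rewrite e0 meval0 map_mxD ev_const G0c0.
  rewrite subrK det1 rmorph1 => e1; by move: (oner_neq0 (residue_field m)); rewrite -e1 eqxx.
exists (f1 * f2); first exact: mulf_neq0.
move=> c; rewrite mevalM mulf_eq0 negb_or f2E => /andP[fc1 /eqP fc2]; split.
  move=> z I2z; apply: (@local_unitM _ _ R_noetherian R_local (\det (ev c D))).
    by move/residue_eq0.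
  apply: num_det => // q; rewrite map_mxD ev_const rowD eltD G0E.
  apply: ideal_addP; first by apply: adj_sub; exact: (hrho q).2.
  have -> : elt (row q (C *m w)) = row q C 0 0 * elt w.
    by rewrite row_mul -mulmxA [LHS]mxE big_ord1.
  exact: adj_mem.
move=> r z mr I2z.
have : ideal_span [seq p.@[coords c] | p <- P] r by apply: hf1 mr; rewrite -cE.
pose N := ideal_colon (num c) (ideal_span [:: z]).
have NE x : num c (x * z) -> N x.
  by move=> Nx _ /mem_span1[y ->]; rewrite mulrCA; exact: ideal_mulP.
suff : ideal_span [seq p.@[coords c] | p <- P] `<=` N.
  by move=> /[apply] /(_ z (span_mem (mem_head _ _))).
apply: span_min => _ /mapP[p pP ->]; apply: NE.
move: pP; rewrite in_cons => /predU1P[->|/mapP[j _ ->]]; rewrite detE; apply: num_det => //.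
by move=> q; rewrite G0E; exact: (hrho q).2.
Qed.

End GenericLength.
Arguments combinations {R d a} c.
Arguments num {R} I {d a} c.
(** * Quotients of length at most one *)

Section LengthOne.
Variables (R : comPzRingType) (m : maxideal R).
Hypotheses (R_noetherian : noetherian R) (R_local : local_ring m).
Implicit Types (A B C L N : ideal R).

Lemma length_le_no_chain L N A B C : length_le L N 1 -> N `<=` A -> C `<=` L ->
  A `<` B -> B `<` C -> False.
Proof.
move=> len NA CL AB BC.
suff : (2 <= 1)%N by [].
have AC : A `<` C by exact: proper_sub_trans (properW BC).
apply: (len 2 (fun i => nth A [:: A; B; C] i)).
  have NB : N `<=` B by apply: subset_trans (properW AB).
  move=> [[|[|[|//]]] i3] /=; split=> //.
  - by apply: subset_trans CL; exact: properW.
  - by apply: subset_trans CL; exact: properW.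
  - by apply: subset_trans (properW BC).
by move=> [[|[|[|//]]] i3] [[|[|[|//]]] j3].
Qed.

(** Any u in L outside N serves: N < N + (u) < L and N < N + (r u) < N + (u) would be chains of
    length two. The last inclusion is strict because 1 - c r is a unit for r in m. If L = N, take w
    = 0. *)
Lemma length_le1_generator L N : N `<=` L -> length_le L N 1 ->
  exists w, [/\ L w, L `<=` ideal_adj N w & forall r, m r -> N (r * w)].
Proof.
move=> NL len.
have [LN|/existsNP[u /not_implyP[Lu Nu]]] := pselect (L `<=` N).
  exists 0; split=> [|z /LN|r _]; first exact: ideal_has0.
    exact: adj_sub.
  by rewrite mulr0; exact: ideal_has0.
have Nadj z : ~ N z -> N `<` ideal_adj N z.
  by move=> Nz; split; [exact: adj_sub|move=> /(_ z (@adj_id _ _ _))].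
exists u; split=> // [z Lz|r mr]; apply: contrapT => h.
  apply: (@length_le_no_chain L N N (ideal_adj N u) L) => //; first exact: Nadj.
  by split; [exact: adj_min|move=> /(_ z Lz)].
apply: (@length_le_no_chain L N N (ideal_adj N (r * u)) (ideal_adj N u)) => //.
- exact: adj_min.
- exact: Nadj.
split; first by apply: adj_min; [exact: adj_sub|exact: adj_mem].
move=> /(_ u (@adj_id _ _ _))/mem_adj[n [c [Nn e]]]; apply: Nu.
apply: (@local_unitM _ _ R_noetherian R_local (1 - c * r)).
  by apply: max_1B; exact: ideal_mulP.
by have -> : (1 - c * r) * u = n by rewrite mulrBl mul1r [X in X - _]e; ring.
Qed.

Variable K : ideal R.
Local Notation pi := (quot_proj K).

Lemma mem_ext_quot (I : ideal R) z : ideal_ext pi I z <-> exists2 a, I a & z = pi a.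
Proof.
split=> [|[a Ia ->]]; last by apply: sub_ideal_gen; exists a.
have @J : ideal (quot K).
  exists [set z | exists2 a, I a & z = pi a].
  - by exists 0; [exact: ideal_has0|rewrite rmorph0].
  - move=> x y [a Ia ->] [b Ib ->]; exists (a + b); first exact: ideal_addP.
    by rewrite rmorphD.
  - elim/quot_ind => c x [a Ia ->].
    by exists (c * a); [exact: ideal_mulP|rewrite rmorphM].
by move=> /(_ J); apply=> _ [a Ia <-]; exists a.
Qed.

Lemma ext_quot_exp (I : ideal R) n z :
  (ideal_ext pi I ^+ n)%ideal z <-> exists2 a, (I ^+ n)%ideal a & z = pi a.
Proof.
elim: n z => [|n IHn] z.
  by split=> // _; exists (repr z) => //; rewrite quot_repr.
split=> [|[a Ia ->]].
  rewrite -mem_ext_quot; move: z; apply: ideal_mul_min => _ x /mem_ext_quot[a Ia ->].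
  move=> /IHn[b Ib ->]; apply: sub_ideal_gen; exists (a * b); last by rewrite rmorphM.
  exact: ideal_mul_mem.
have @J : ideal R.
  exists [set a | (ideal_ext pi I ^+ n.+1)%ideal (pi a)].
  - by rewrite /mkset rmorph0; exact: ideal_has0.
  - by move=> x y Jx Jy; rewrite /mkset rmorphD; exact: ideal_addP.
  - by move=> c x Jx; rewrite /mkset rmorphM; exact: ideal_mulP.
move: a Ia; apply: (@ideal_mul_min _ _ _ J) => a b Ia Ib.
suff : (ideal_ext pi I ^+ n.+1)%ideal (pi (a * b)) by [].
rewrite rmorphM; apply: ideal_mul_mem; first by apply/mem_ext_quot; exists a.
by apply/IHn; exists b.
Qed.

(** In a chain c_0 < c_1 < c_2, an element of c_1 outside c_0 is r w modulo [Nbar] with r a unit,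
    since m w is zero there. So c_1 contains w and hence everything. *)
Lemma length_le1_quot (I N : ideal R) (Nbar : ideal (quot K)) w :
  (forall n, N n -> Nbar (pi n)) -> (I ^+ 2)%ideal `<=` ideal_adj N w ->
  (forall r, m r -> N (r * w)) -> length_le (ideal_ext pi I ^+ 2)%ideal Nbar 1.
Proof.
move=> NN genw socw k c cb cinc; rewrite leqNgt; apply/negP => k1.
pose i0 : 'I_k.+1 := ord0.
have i1P : (1 < k.+1)%N by exact: ltnW.
pose i1 : 'I_k.+1 := Ordinal i1P; pose i2 : 'I_k.+1 := Ordinal (k1 : (2 < k.+1)%N).
have [_ /existsNP[u /not_implyP[c1u c0u]]] := cinc i0 i1 isT.
have [_ /existsNP[v /not_implyP[c2v c1v]]] := cinc i1 i2 isT.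
have decomp z : (ideal_ext pi I ^+ 2)%ideal z ->
    exists r n, Nbar n /\ z = n + pi r * pi w.
  move=> /ext_quot_exp[a /genw/mem_adj[n [r [Nn ->]]] ->]; exists r, (pi n).
  by split; [exact: NN|rewrite rmorphD rmorphM].
have [r [n [Nn e]]] := decomp u ((cb i1).2 u c1u).
have mr : ~ m r.
  move=> mr; apply: c0u; apply: (cb i0).1; rewrite e; apply: ideal_addP => //.
  by rewrite -rmorphM; apply/NN/socw.
have c1w : c i1 (pi w).
  have [y yr] := local_unit R_noetherian R_local mr.
  have -> : pi w = pi y * (u - n).
    rewrite e addrC addKr mulrA; rewrite -[pi y * pi r]rmorphM yr.
    by rewrite rmorph1 mul1r.
  apply: ideal_mulP; apply: ideal_subP => //; exact: (cb i1).1.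
have [r' [n' [Nn' e']]] := decomp v ((cb i2).2 v c2v).
apply: c1v; rewrite e'; apply: ideal_addP; first exact: (cb i1).1.
exact: ideal_mulP.
Qed.

End LengthOne.

Theorem theorem5p3 (R : comNzRingType) (m : maxideal R) (d : nat)
    (I : ideal R) (y : d.-tuple R)
    (R_noetherian : noetherian R) (R_local : local_ring m)
    (R_CM : cohen_macaulay R) (R_dim : has_krull_dim R d) (d_ge1 : (1 <= d)%N)
    (R_equichar : [pchar R] =i [pchar residue_field m])
    (k_infinite : infinite_set [set: residue_field m])
    (I_proper : is_proper I) (I_spread : has_analytic_spread m I d)
    (H_red : minimal_reduction (ideal_span y) I)
    (H_length : length_le (I ^+ 2)
       (ideal_span [:: y`_d.-1] * I + I ^+ 3
         + (ideal_sat (ideal_span (take d.-1 y)) I :&: I ^+ 2)) 1)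
    (H_cond :
       (primary_to m I /\
        (ideal_span y :&: I ^+ 2 = ideal_span y * I)%ideal)
       \/
       [/\ exists2 n, has_depth (quot I) n & (1 <= n)%N,
           G_condition I d,
           AN_minus I (d%:Z - 2) &
           geometric_residual_intersection (take d.-1 y) I]) :
  j_stretched m d I.
Proof.
move=> a Ia.
have [red _] := H_red; have [yI _] := red.
have yd_y : y`_d.-1 \in (y : seq R) by rewrite mem_nth// size_tuple prednK.
have sat_cap z : ideal_sat (ideal_span (take d.-1 y)) I z -> (I ^+ 2)%ideal z ->
    (ideal_span y * I)%ideal z.
  case: H_cond => [[primI capI]|[dI GI ANI geo]].
    exact: (primary_sat_cap R_noetherian R_local k_infinite R_CM R_dim).
  move=> satz I2z.
  have : (ideal_span (take d.-1 y) * I)%ideal z.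
    apply: (residual_sat_cap_ring R_noetherian R_local k_infinite R_CM R_dim)
      dI GI ANI geo _ satz I2z => //.
    by rewrite size_takel// size_tuple leq_pred.
  move: z {satz I2z}; apply: ideal_mul_min => u v ys Iv; apply: ideal_mul_mem => //.
  by move: u ys; apply: span_min => x /mem_take; exact: span_mem.
have /choice[L0 hL0] : forall i : 'I_d, exists c : nat -> R,
    tnth y i = \sum_(j < size a) c j * a`_j.
  by move=> i; apply/mem_span; rewrite -Ia; apply: yI; apply: span_mem; exact: mem_tnth.
(* The base point of the deformation: coefficients of y in the given generators of I. *)
pose c0 : 'M[R]_(d, size a) := \matrix_(i, j) L0 i j.
have yE : combinations c0 = y.
  apply: eq_from_tnth => i; rewrite tnth_mktuple hL0.
  by apply: eq_bigr => j _; rewrite mxE.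
set N1 := (_ + _)%ideal in H_length.
have N1I : N1 `<=` (I ^+ 2)%ideal.
  apply: ideal_add_min; last by move=> z [].
  apply: ideal_add_min; last exact: ideal_expS_sub.
  rewrite ideal_exp2; apply: ideal_mul_min => u v /mem_span1[r ->] Iv.
  by apply: ideal_mul_mem => //; apply: ideal_mulP; exact/yI/span_mem.
(* Here the saturation is absorbed into H I. Passing from [N1] to the larger ideal keeps w a
   generator killed by m. *)
have N1num : N1 `<=` num I c0.
  rewrite /num yE; apply: ideal_add_min.
    apply: ideal_add_min; last exact: ideal_add_subr.
    apply: subset_trans (@ideal_add_subl _ _ _).
    apply: ideal_mul_min => u v /mem_span1[r ->] Iv.
    by apply: ideal_mul_mem => //; apply: ideal_mulP; exact: span_mem.
  by move=> z [satz I2z]; apply: ideal_add_subl; exact: sat_cap.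
have [w0 [I2w genw socw]] := length_le1_generator R_noetherian R_local N1I H_length.
have [sb I2E] := R_noetherian (I ^+ 2)%ideal.
pose b : 'cV[R]_(size sb) := \col_i sb`_i.
have b_mem q : (I ^+ 2)%ideal (b q 0) by rewrite I2E mxE; exact: span_nth.
have b_gen z : (I ^+ 2)%ideal z -> exists u : 'rV_(size sb), z = (u *m b) 0 0.
  rewrite I2E => /mem_span[c ->]; exists (\row_i c i); rewrite mxE.
  by apply: eq_bigr => i _; rewrite !mxE.
have [w wE] := b_gen _ I2w.
have [||f f0 hf] := generic_num R_noetherian R_local Ia b_mem b_gen (c0 := c0) (w := w).
- move=> z /genw; rewrite -wE; move: z; apply: adj_min; last exact: adj_id.
  by apply: subset_trans (@adj_sub _ _ _).
- by move=> r /socw/N1num; rewrite -wE.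
have [Uopen Udense] := mpoly_open_dense k_infinite f0.
exists [set v | f.@[v] != 0]; split=> // c /hf[gen soc] K xd Ibar.
apply: (length_le1_quot R_noetherian R_local (N := num I c) (w := w0)).
- rewrite /Ibar => n /mem_ideal_add[h [t [hx I3t ->]]]; rewrite rmorphD.
  apply: ideal_addP; last by apply: ideal_add_subr; apply/ext_quot_exp; exists t.
  apply: ideal_add_subl.
  move: hx => /mem_span_mul[g [Ig ->]]; rewrite size_tuple rmorph_sum.
  apply: ideal_sumP => i _.
  (* Only the last term, that of x_d, survives in R/K; x_1, ..., x_(d-1) lie in K. *)
  have [id|id] := eqVneq (i : nat) d.-1.
    rewrite rmorphM mulrC; apply: ideal_mul_mem; last by apply/mem_ext_quot; exists (g i).
    by rewrite id; exact: span_mem (mem_head _ _).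
  have i_d : (i < d.-1)%N by rewrite ltn_neqAle id -ltnS prednK// ltn_ord.
  (* The saturation asks for a positive exponent, and 1 suffices for elements of J_(d-1) itself. *)
  have Ki : K (combinations c)`_i.
    exists 1 => // x _; apply: ideal_mulPr; apply: span_mem.
    by rewrite -(nth_take 0 i_d) mem_nth// size_takel// size_tuple leq_pred.
  have e0 : quot_proj K (g i * (combinations c)`_i) = 0.
    rewrite -(rmorph0 (quot_proj K)); apply/quot_projP; rewrite subr0.
    exact: ideal_mulP.
  rewrite [X in ideal_set _ X]e0; exact: ideal_has0.
- by rewrite wE.
- by move=> r mr; exact: soc.
Qed.
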